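(* Let $1\le p\le\infty$ and $\alpha>0$. Then $C^\beta\cap L^{\alpha,p}$ is dense in $L^{\alpha,p}$ for all $0<\beta\le\alpha$ if $\alpha<1$, and for all $0<\beta<1$ if $\alpha\ge1$.
   Context: Setting: $(X,d,m)$ is a metric space with a Borel measure $m$ such that $m(X)=\infty$ and, for some $N>0$ (Ahlfors $N$-regularity), $c^{-1}r^N\le m(B(x,r))\le c\,r^N$ for all $x\in X$, $r>0$, with $c$ independent of $x,r$. Approximation of the identity: fix a non-negative decreasing $C^\infty$ function $h:[0,\infty)\to\mathbb{R}$ with $h\equiv1$ on $[0,1/2]$ and $h\equiv0$ on $[2,\infty)$. For $t>0$ let $T_tf(x)=t^{-N}\int_X h(d(x,y)/t)f(y)\,dm(y)$, $\varphi(x,t)=1/T_t1(x)$, $\psi(x,t)=1/T_t\left(\frac{1}{T_t1}\right)(x)$, and $$s(x,y,t)=\frac{\varphi(x,t)\varphi(y,t)}{t^{2N}}\int_X h\left(\tfrac{d(x,z)}{t}\right)h\left(\tfrac{d(y,z)}{t}\right)\psi(z,t)\,dm(z).$$ Bessel potential: for $\alpha>0$, $k_\alpha(x,y)=\alpha\int_0^\infty\frac{t^\alpha}{(1+t^\alpha)^2}s(x,y,t)\frac{dt}{t}$ and $J_\alpha g(x)=\int_X g(z)k_\alpha(x,z)\,dm(z)$; $J_\alpha$ is a contraction on $L^p$, $1\le p\le\infty$. Potential space: $L^{\alpha,p}=J_\alpha(L^p)$ with norm $\|f\|_{\alpha,p}=\|f\|_p+\inf\{\|g\|_p: g\in L^p,\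 J_\alpha g=f\}$. $C^\beta$ is the space of bounded functions $f$ with $[f]_\beta=\sup_{x\neq y}|f(x)-f(y)|/d(x,y)^\beta<\infty$ (functions being identified if equal a.e.). *)

(* Defs.v *)
From HB Require Import structures.
From mathcomp Require Import all_boot all_order all_algebra.
From mathcomp Require Import all_classical all_reals all_analysis.

Set Implicit Arguments.
Unset Strict Implicit.
Unset Printing Implicit Defensive.

Import Order.TTheory GRing.Theory Num.Theory.
Import numFieldNormedType.Exports.

Local Open Scope classical_set_scope.
Local Open Scope ring_scope.

(* The two structures are unrelated: that the sigma-algebra is the Borel one has
   to be assumed separately, see [is_borel]. Nonemptiness comes from
   [measurableType]; it is no restriction when the total mass is infinite. *)
#[short(type="measurableMetricType")]
HB.structure Definition MeasurableMetric (d : measure_display)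
    (R : numDomainType) :=
  { X of Metric R X & Measurable d X }.

Definition is_borel d (R : realType) (X : measurableMetricType d R) : Prop :=
  @measurable d X = <<s @open X >>.

Definition ahlfors_regular d (R : realType) (X : measurableMetricType d R)
    (m : {measure set X -> \bar R}) (N : R) : Prop :=
  exists2 c : R, 0 < c & forall (x : X) (r : R), 0 < r ->
    ((c^-1 * r `^ N)%:E <= m (ball x r) <= (c * r `^ N)%:E)%E.

Definition smooth (R : realType) (f : R -> R) : Prop :=
  forall (n : nat) (x : R), derivable (derive1n n f) x 1.

(* Profiles on [0, +oo[ are represented by functions on R whose values at
   negative arguments are irrelevant; smoothness up to the boundary point 0
   means existence of a smooth extension to R. *)
Record admissible_profile (R : realType) (h : R -> R) : Prop := {
  profile_smooth :
    exists2 H : R -> R, smooth H & forall r, 0 <= r -> H r = h r;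
  profile_ge0 : forall r, 0 <= r -> 0 <= h r;
  profile_decr : forall r s, 0 <= r -> r <= s -> h s <= h r;
  profile_one : forall r, 0 <= r -> r <= 2^-1 -> h r = 1;
  profile_zero : forall r, 2 <= r -> h r = 0
}.

Section bessel_potential.
Context d (R : realType) (X : measurableMetricType d R).
Variables (m : {measure set X -> \bar R}) (N : R) (h : R -> R).
Implicit Types (f g : X -> R) (x y z : X) (t alpha beta : R) (p : \bar R).

Definition avg_op t f x : R :=
  t `^ (- N) * \int[m]_y (h (mdist x y / t) * f y).

Definition phi x t : R := (avg_op t (cst 1) x)^-1.

Definition psi x t : R := (avg_op t (fun y => (avg_op t (cst 1) y)^-1) x)^-1.

Definition s_kernel x y t : R :=
  phi x t * phi y t / t `^ (2 * N) *
  \int[m]_z (h (mdist x z / t) * h (mdist y z / t) * psi z t).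

(* Extended-real valued: the integral diverges on the diagonal when
   alpha <= N. *)
Definition bessel_kernel alpha x y : \bar R :=
  (alpha%:E * \int[@lebesgue_measure R]_(t in `]0%R, +oo[)
     (t `^ alpha / (1 + t `^ alpha) ^+ 2 * s_kernel x y t / t)%:E)%E.

Definition bessel_potential alpha g x : \bar R :=
  (\int[m]_z ((g z)%:E * bessel_kernel alpha x z))%E.

(* g is in L^p and J_alpha g = f almost everywhere. Since f is real-valued, the
   convention +oo - oo = -oo is harmless: where the integral is finite, so are
   the integrals of the positive and negative parts. *)
Definition bessel_preimage alpha p f : set (X -> R) :=
  [set g | g \in Lfun m p /\ bessel_potential alpha g = EFin \o f %[ae m]].

(* Function spaces are sets of functions that are saturated under almost
   everywhere equality, instead of sets of equivalence classes. *)
Definition potential_space alpha p : set (X -> R) :=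
  [set f | measurable_fun setT f /\ bessel_preimage alpha p f !=set0].

Definition potential_norm alpha p f : \bar R :=
  ('N[m]_p[EFin \o f] +
   ereal_inf [set 'N[m]_p[EFin \o g] | g in bessel_preimage alpha p f])%E.

Definition holder_seminorm beta f : \bar R :=
  ereal_sup [set u | exists x y,
    x != y /\ u = (`|f x - f y| / mdist x y `^ beta)%:E].

Definition holder_space beta : set (X -> R) :=
  [set f | exists u : X -> R,
    [/\ exists M : R, forall x, `|u x| <= M,
        (holder_seminorm beta u < +oo)%E &
        f = u %[ae m]]].

End bessel_potential.

Definition dense_for (R : realType) (V : zmodType) (norm : V -> \bar R)
    (A E : set V) : Prop :=
  A `<=` E /\
  forall f, E f -> forall e : R, 0 < e ->
    exists2 u, A u & (norm (f - u)%R < e%:E)%E.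

(* Main.v *)
Require Import Defs.
From HB Require Import structures.
From mathcomp Require Import all_boot all_order all_algebra.
From mathcomp Require Import all_classical all_reals all_analysis.
From mathcomp Require Import measurable_realfun ess_sup_inf.
From mathcomp Require Import ring lra.

Set Implicit Arguments.
Unset Strict Implicit.
Unset Printing Implicit Defensive.

Import Order.TTheory GRing.Theory Num.Theory.
Import numFieldNormedType.Exports.

Local Open Scope classical_set_scope.
Local Open Scope ring_scope.

(** The operator J_alpha has a nonnegative symmetric kernel k with
    sup_x int k(x, .) dm < oo, hence is bounded on every L^p by Schur's test, and
    it maps bounded functions to Holder functions: s(., z, t) has size t^-N, is
    Lipschitz with constant of order t^(-N-1) and is supported at distance < 4t
    from z, so that int |s(x, z, t) - s(y, z, t)| dm(z) <= C min(1, d(x, y) / t),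
    and since the weight alpha t^(alpha-1) / (1 + t^alpha)^2 is at most
    alpha t^(beta-1), integrating in t gives C d(x, y)^beta for 0 < beta < 1,
    beta <= alpha. Given f = J_alpha g, truncate g at height n: u = J_alpha (g 1_(|g| <= n))
    is bounded and Holder continuous, and
    ||f - u||_(alpha, p) <= C ||g 1_(|g| > n)||_p, which is small for large n, also
    for p = oo. Regularity of m makes X separable, so that the distance is
    measurable for the product sigma-algebra and Tonelli's theorem applies. *)

(** * Separability and measurability of the distance *)

(** The kernel [k] may be +oo on the diagonal and g is only in L^p, so differences of potentials are
    postponed as long as possible: comparisons are proved for nonnegative functions, in the additive
    form [A <= B + C] in the extended reals, and signed functions are split into positive and
    negative parts once finiteness is known. The dependence of s(x, z, t) on x passes only through
    [phi] and one factor [h], both Lipschitz at scale t; [psi] is evaluated at the integration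
    variable, so an upper bound on it suffices. Both cases of the theorem reduce to the single
    condition 0 < beta < 1, beta <= alpha. The bound beta <= alpha lets t^(beta-1) dominate the
    weight for small t; beta < 1 makes d(x, y) t^(beta-2) integrable for t > d(x, y). The infimum in
    the potential norm of f - u is under control because the discarded part of g is itself a
    preimage of f - u. *)

Lemma measurable_funV d (T : measurableType d) (R : realType) (f : T -> R) :
  measurable_fun setT f -> measurable_fun setT (fun x => (f x)^-1).
Proof.
(* Inversion is not continuous at 0, whereas real powers are measurable. The power -1 is taken of a
   square; the factor [f x] then restores the sign, and the value 0 that [^-1] takes at 0. *)
move=> mf; have -> : (fun x => (f x)^-1) = fun x => f x * (f x ^+ 2) `^ (-1).
  apply/funext => x; rewrite powR_inv1 ?sqr_ge0// expr2.
  by have [->|fx0] := eqVneq (f x) 0; rewrite ?invr0 ?mul0r// invfM mulVKf.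
apply: measurable_funM => //.
apply: (@measurableT_comp _ _ _ _ _ _ (@powR R ^~ (-1))) => //.
exact: measurable_funX.
Qed.

Section metric_measurability.
Context d (R : realType) (X : measurableMetricType d R).
Hypothesis hX : is_borel X.

Lemma borel_measurable_ball (x : X) (r : R) : measurable (ball x r).
Proof.
rewrite hX; apply: sub_sigma_algebra; rewrite openE => y; rewrite ballEmdist/= => xy.
apply/nbhs_ballP; exists (r - mdist x y) => /=; first by rewrite subr_gt0.
move=> z; rewrite !ballEmdist/= => yz.
by rewrite (le_lt_trans (metric_triangle x y z))// addrC -ltrBrDr.
Qed.

Lemma measurable_mdistl (x : X) : measurable_fun setT (mdist x).
Proof.
apply: (measurability _ (RGenInftyO.measurableE R)) => _ [_ [r ->] <-].
rewrite setTI (_ : _ @^-1` _ = ball x r); first exact: borel_measurable_ball.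
by rewrite ballEmdist; apply/seteqP; split => z /=; rewrite in_itv.
Qed.

(** Open sets of the product need not lie in the product sigma-algebra in general, so continuity of
    the distance is not enough. With a dense sequence, [mdist x y < r] holds iff the distances of
    some [D n] to x and to y add up to less than r: a countable union of conditions on sums of
    functions of one variable. *)
Lemma measurable_mdist (D : nat -> X) :
  (forall x (e : R), 0 < e -> exists n, mdist x (D n) < e) ->
  measurable_fun setT (fun z : X * X => mdist z.1 z.2).
Proof.
move=> hD; apply: (measurability _ (RGenInftyO.measurableE R)) => _ [_ [r ->] <-].
rewrite setTI (_ : _ @^-1` _ = \bigcup_n
    (fun z : X * X => mdist (D n) z.1 + mdist (D n) z.2) @^-1` `]-oo, r[).
  apply: bigcupT_measurable => n; rewrite -[X in measurable X]setTI.
  apply: (_ : measurable_fun setT _) => //.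
  by apply: measurable_funD; apply: measurableT_comp => //; exact: measurable_mdistl.
apply/seteqP; split => -[x y] /=; rewrite in_itv/=.
  move=> xyr; have [|n nx] := hD x ((r - mdist x y) / 2).
    by rewrite divr_gt0// subr_gt0.
  exists n => //=; rewrite in_itv/=.
  have := metric_triangle (D n) x y; rewrite (metric_sym (D n) x); lra.
move=> [n _ /=]; rewrite in_itv/=; apply: le_lt_trans.
by rewrite (metric_sym (D n) x); exact: metric_triangle.
Qed.

End metric_measurability.

(** * Separability and sigma-finiteness from Ahlfors regularity *)

Section ahlfors.
Context d (R : realType) (X : measurableMetricType d R).
Hypothesis hX : is_borel X.
Variables (m : {measure set X -> \bar R}) (N c : R).
Hypothesis c0 : 0 < c.
Hypothesis reg : forall (x : X) (r : R), 0 < r ->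
  ((c^-1 * r `^ N)%:E <= m (ball x r) <= (c * r `^ N)%:E)%E.

Let mball := borel_measurable_ball hX.

(** Packing by volume: if no finite net existed, points at mutual distance at least e could be added
    forever. Their balls of radius e / 2 are disjoint, have mass at least [v] each, and all lie in
    the ball of radius r + e, whose mass is finite. *)
Lemma ahlfors_finite_net (x0 : X) (r e : R) : 0 < r -> 0 < e ->
  exists s : seq X, forall x, mdist x0 x < r -> exists2 y, y \in s & mdist x y < e.
Proof.
move=> r0 e0; apply: contrapT => /forallNP Hs.
pose B (s : seq X) := \bigcup_(y in [set` s]) ball y (e / 2).
have e20 : 0 < e / 2 by rewrite divr_gt0.
pose v := c^-1 * (e / 2) `^ N.
have v0 : 0 < v by rewrite mulr_gt0 ?invr_gt0// powR_gt0.
have mB s : measurable (B s).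
  by apply: fin_bigcup_measurable => // y _; exact: mball.
have {}Hs n : exists s : seq X, [/\ size s = n,
    (forall y, y \in s -> mdist x0 y < r) & ((n%:R * v)%:E <= m (B s))%E].
  elim: n => [|n [s [sn sr ms]]].
    by exists [::]; split => //; rewrite mul0r.
  have /existsNP[x /not_implyP[xr xs]] := Hs s.
  exists (x :: s); split => /=; first by rewrite sn.
  - by move=> y; rewrite inE => /predU1P[->//|]; exact: sr.
  - have -> : B (x :: s) = ball x (e / 2) `|` B s.
      apply/seteqP; split => z.
        move=> [y /=]; rewrite inE => /predU1P[->|ys] yz; [by left|right].
        by exists y.
      case=> [xz|[y ys yz]]; first by exists x => //=; rewrite inE eqxx.
      by exists y => //=; rewrite inE; apply/orP; right.
    rewrite measureU//.
      rewrite -natr1 mulrDl mul1r addrC EFinD leeD//.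
      by have /andP[] := reg x e20.
    apply/seteqP; split => // z [] /= + [y ys]; rewrite !ballEmdist/= => xz yz.
    apply: xs; exists y => //; have := metric_triangle x z y.
    by rewrite (metric_sym z); lra.
have le n : n%:R * v <= c * (r + e) `^ N.
  have [s [_ sr ms]] := Hs n; rewrite -lee_fin (le_trans ms)//.
  have /andP[_] := @reg x0 (r + e) (addr_gt0 r0 e0); apply: le_trans.
  apply: le_measure; rewrite ?inE//.
  move=> z [y /= /sr ys]; rewrite !ballEmdist/= => yz.
  have := metric_triangle x0 y z; lra.
have := le (Num.truncn (c * (r + e) `^ N / v)).+1.
by rewrite leNgt -ltr_pdivrMr// truncnS_gt.
Qed.

Lemma ahlfors_separable :
  exists D : nat -> X, forall x (e : R), 0 < e -> exists n, mdist x (D n) < e.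
Proof.
pose x0 : X := point.
have H (nk : nat * nat) : exists s : seq X, forall x,
    mdist x0 x < nk.1.+1%:R -> exists2 y, y \in s & mdist x y < nk.2.+1%:R^-1.
  by apply: ahlfors_finite_net; rewrite ?invr_gt0 ltr0n.
have [S HS] := choice H.
(* There is one finite net of mesh 1 / (k + 1) for each ball of radius n + 1 about [x0]; an integer
   codes n, k and a position in that net. *)
exists (fun j => if @unpickle (nat * nat * nat)%type j is Some (nk, i)
  then nth x0 (S nk) i else x0) => x e e0.
have [y yS xy] := HS (Num.truncn (mdist x0 x), Num.truncn e^-1) x (truncnS_gt _).
exists (pickle (Num.truncn (mdist x0 x), Num.truncn e^-1, index y (S (Num.truncn (mdist x0 x), Num.truncn e^-1)))).
rewrite pickleK nth_index// (lt_le_trans xy)//=.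
rewrite -[leRHS]invrK lef_pV2 ?posrE ?invr_gt0 ?ltr0n//.
by rewrite ltW// truncnS_gt.
Qed.

Lemma measurable_ahlfors_mdist :
  measurable_fun setT (fun z : X * X => mdist z.1 z.2).
Proof. by have [D HD] := ahlfors_separable; exact: measurable_mdist HD. Qed.

Lemma ahlfors_sigma_finite : sigma_finite setT m.
Proof.
exists (fun n => ball (point : X) n.+1%:R).
  apply/esym/seteqP; split => // x _; exists (Num.truncn (mdist (point : X) x)) => //.
  by rewrite ballEmdist/= truncnS_gt.
move=> n; split; first exact: mball.
have /andP[_ h] := @reg point n.+1%:R (ltr0Sn _ _).
by rewrite (le_lt_trans h)// ltry.
Qed.

End ahlfors.

(** Tonelli's theorem is applied to bundled sigma-finite measures, while the main theorem quantifies
    over a bare measure; the equality allows one to be substituted for the other. *)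
Lemma sigma_finite_measure_of d (T : measurableType d) (R : realType)
    (mu : {measure set T -> \bar R}) : sigma_finite setT mu ->
  exists nu : {sigma_finite_measure set T -> \bar R}, mu = nu.
Proof.
case: mu => mu [mu1 mu2].
set M : {measure set T -> \bar R} := Measure.Pack _ => smu.
pose H1 := isSFinite.Build _ _ _ M (sfinite_measure_sigma_finite smu).
pose H2 := isSigmaFinite.Build _ _ _ M smu.
pose nu : {sigma_finite_measure set T -> \bar R} := HB.pack (Measure.sort M) H1 H2.
by exists nu.
Qed.


(** * Estimates on the kernel s *)

Section parametric_integral.
Context d (X : measurableType d) (R : realType).
Variable m : {sigma_finite_measure set X -> \bar R}.

Lemma measurable_integral_param d' (T : measurableType d') (f : T -> X -> \bar R) :
  measurable_fun setT (fun z : T * X => f z.1 z.2) -> (forall a y, 0 <= f a y)%E ->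
  measurable_fun setT (fun a => \int[m]_y f a y)%E.
Proof.
move=> mf f0; exact: (measurable_fun_fubini_tonelli_F (m2 := m) _ mf (fun z => f0 z.1 z.2)).
Qed.

Lemma measurable_Rintegral_param d' (T : measurableType d') (f : T -> X -> R) :
  measurable_fun setT (fun z : T * X => f z.1 z.2) -> (forall a y, 0 <= f a y) ->
  measurable_fun setT (fun a => \int[m]_y f a y).
Proof.
move=> mf f0; apply: (@measurableT_comp _ _ _ _ _ _ fine).
  exact: fine_measurable.
apply: measurable_integral_param => [|a y]; last by rewrite lee_fin.
exact/measurable_EFinP.
Qed.

End parametric_integral.

(** These are the properties of the profile that the estimates use, smoothness being reduced to a
    Lipschitz constant. They are required at negative arguments too, since the measurability lemmas
    let the scale t run over all of R, where [mdist x y / t] may be negative. *)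
Record lipschitz_bump (R : realType) (h : R -> R) (L : R) : Prop := {
  bump_measurable : measurable_fun setT h;
  bump_ge0 : forall r, 0 <= h r;
  bump_le1 : forall r, h r <= 1;
  bump_one : forall r, r <= 2^-1 -> h r = 1;
  bump_zero : forall r, 2 <= r -> h r = 0;
  bump_lip : forall r s, `|h r - h s| <= L * `|r - s|
}.

Section kernel.
Context d (R : realType) (X : measurableMetricType d R).
Hypothesis hX : is_borel X.
Variables (m : {sigma_finite_measure set X -> \bar R}) (N c : R).
Hypothesis c0 : 0 < c.
Hypothesis reg : forall (x : X) (r : R), 0 < r ->
  ((c^-1 * r `^ N)%:E <= m (ball x r) <= (c * r `^ N)%:E)%E.
Variables (h : R -> R) (L : R).
Hypothesis hh : lipschitz_bump h L.

Let mball := borel_measurable_ball hX.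
Let h0 := bump_ge0 hh.

Local Notation phi := (phi m N h).
Local Notation psi := (psi m N h).
Local Notation s_kernel := (s_kernel m N h).
Local Notation avg_op := (avg_op m N h).

(** * Joint measurability of averages and kernels in points and scale *)

Section measurability.
Context d' (T : measurableType d').
Implicit Types (u v : T -> X) (t : T -> R).

Lemma measurable_mdist_comp u v : measurable_fun setT u -> measurable_fun setT v ->
  measurable_fun setT (fun z => mdist (u z) (v z)).
Proof.
move=> mu mv; apply: (@measurableT_comp _ _ _ _ _ _ (fun z : X * X => mdist z.1 z.2) _
  (fun z => (u z, v z))); last exact: measurable_fun_pair.
exact: measurable_ahlfors_mdist c0 reg.
Qed.

Lemma measurable_bump u v t : measurable_fun setT u -> measurable_fun setT v ->
  measurable_fun setT t -> measurable_fun setT (fun z => h (mdist (u z) (v z) / t z)).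
Proof.
move=> mu mv mt; apply: (@measurableT_comp _ _ _ _ _ _ h); first exact: bump_measurable hh.
by apply: measurable_funM; [exact: measurable_mdist_comp|exact: measurable_funV].
Qed.

End measurability.

Lemma avg_op_ge0 t f x : (forall y, 0 <= f y) -> 0 <= avg_op t f x.
Proof.
move=> f0; rewrite mulr_ge0 ?powR_ge0//; apply: Rintegral_ge0 => y _.
by rewrite mulr_ge0.
Qed.

Lemma phi_ge0 x t : 0 <= phi x t.
Proof. by rewrite invr_ge0; exact: avg_op_ge0. Qed.

Lemma psi_ge0 x t : 0 <= psi x t.
Proof. by rewrite invr_ge0; apply: avg_op_ge0 => y; exact: phi_ge0. Qed.

Lemma s_kernel_ge0 x y t : 0 <= s_kernel x y t.
Proof.
rewrite /Defs.s_kernel mulr_ge0//.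
  by rewrite divr_ge0 ?powR_ge0// mulr_ge0// phi_ge0.
by apply: Rintegral_ge0 => z _; rewrite !mulr_ge0 ?psi_ge0.
Qed.

Lemma s_kernelC x y t : s_kernel x y t = s_kernel y x t.
Proof.
rewrite /Defs.s_kernel [phi x t * _]mulrC; congr (_ * _).
by apply: eq_Rintegral => z _ /=; rewrite [h _ * h _]mulrC.
Qed.

(** The averaged function may depend on the scale because [psi] averages [phi] at the very scale of
    the averaging. *)
Lemma measurable_avg_op d' (T : measurableType d') (u : T -> X) (t : T -> R)
    (f : R -> X -> R) :
  (forall s y, 0 <= f s y) -> measurable_fun setT (fun w : X * R => f w.2 w.1) ->
  measurable_fun setT u -> measurable_fun setT t ->
  measurable_fun setT (fun z => avg_op (t z) (f (t z)) (u z)).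
Proof.
move=> f0 mf mu mt; apply: measurable_funM.
  exact: (@measurableT_comp _ _ _ _ _ _ (@powR R ^~ (- N))).
apply: measurable_Rintegral_param => [|z y]; last by rewrite mulr_ge0.
apply: measurable_funM.
  by apply: measurable_bump => //; apply: measurableT_comp.
apply: (@measurableT_comp _ _ _ _ _ _ (fun w : X * R => f w.2 w.1) _
  (fun z : T * X => (z.2, t z.1))) => //.
by apply: measurable_fun_pair => //; exact: measurableT_comp.
Qed.

Lemma measurable_phi d' (T : measurableType d') (u : T -> X) (t : T -> R) :
  measurable_fun setT u -> measurable_fun setT t ->
  measurable_fun setT (fun z => phi (u z) (t z)).
Proof.
by move=> mu mt; apply: measurable_funV; apply: (measurable_avg_op (f := fun _ _ => 1)).
Qed.

Lemma measurable_psi d' (T : measurableType d') (u : T -> X) (t : T -> R) :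
  measurable_fun setT u -> measurable_fun setT t ->
  measurable_fun setT (fun z => psi (u z) (t z)).
Proof.
move=> mu mt; apply: measurable_funV.
apply: (measurable_avg_op (f := fun s y => phi y s)) => //.
- by move=> s y; exact: phi_ge0.
- exact: measurable_phi.
Qed.

Lemma measurable_s_kernel d' (T : measurableType d') (u v : T -> X) (t : T -> R) :
  measurable_fun setT u -> measurable_fun setT v -> measurable_fun setT t ->
  measurable_fun setT (fun z => s_kernel (u z) (v z) (t z)).
Proof.
move=> mu mv mt; apply: measurable_funM.
  apply: measurable_funM; first by apply: measurable_funM; exact: measurable_phi.
  by apply: measurable_funV; exact: (@measurableT_comp _ _ _ _ _ _ (@powR R ^~ (2 * N))).
apply: measurable_Rintegral_param => [|z y]; last by rewrite !mulr_ge0 ?psi_ge0.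
have mt1 : measurable_fun setT (t \o fst : T * X -> R) by exact: measurableT_comp.
apply: measurable_funM; first apply: measurable_funM.
- by apply: measurable_bump => //; apply: measurableT_comp.
- by apply: measurable_bump => //; apply: measurableT_comp.
- exact: measurable_psi.
Qed.

(** Bounds for T_t 1: the bump is 1 on the ball of radius t / 2, of mass at least [a * t ^ N], and
    vanishes outside the ball of radius 2t, of mass at most [b * t ^ N]. Tying them by equations
    keeps them atomic in the algebra below. *)
Variables a b : R.
Hypotheses (aE : a = c^-1 * 2^-1 `^ N) (bE : b = c * 2 `^ N).

Let a0 : 0 < a. Proof. by rewrite aE mulr_gt0 ?invr_gt0// powR_gt0. Qed.
Let b0 : 0 < b. Proof. by rewrite bE mulr_gt0// powR_gt0. Qed.

Lemma integral_indic_ball (x : X) (r M : R) : 0 <= M ->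
  (\int[m]_y (M * \1_(ball x r) y)%:E = M%:E * m (ball x r))%E.
Proof.
move=> M0; under eq_integral do rewrite EFinM.
rewrite ge0_integralZl//; last by apply/measurable_EFinP; exact: measurable_indic.
by rewrite integral_indic// setIT.
Qed.

Lemma integral_indic_ball_le (x : X) (r M : R) : 0 < r -> 0 <= M ->
  (\int[m]_y (M * \1_(ball x r) y)%:E <= (M * (c * r `^ N))%:E)%E.
Proof.
move=> r0 M0; rewrite integral_indic_ball// EFinM lee_wpmul2l ?lee_fin//.
by have /andP[] := reg x r0.
Qed.

Let measurable_indic_ball (x : X) (r M : R) :
  measurable_fun [set: X] (fun y => (M * \1_(ball x r) y)%:E).
Proof. by apply/measurable_EFinP; apply: measurable_funM => //; exact: measurable_indic. Qed.

Lemma indic_ball (x y : X) (r : R) : \1_(ball x r) y = (mdist x y < r)%R%:R :> R.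
Proof.
rewrite indicE; have [xy|xy] := ltP (mdist x y) r.
  by rewrite mem_set// ballEmdist.
by rewrite memNset// ballEmdist/= ltNge xy.
Qed.

Lemma integral_supp_ball_le (f : X -> R) (x : X) (r M : R) : 0 < r -> 0 <= M ->
  measurable_fun setT f ->
  (forall y, 0 <= f y) -> (forall y, f y <= M) -> (forall y, r <= mdist x y -> f y = 0) ->
  (\int[m]_y (f y)%:E <= (M * (c * r `^ N))%:E)%E.
Proof.
move=> r0 M0 mf f0 fM fz; apply: le_trans (integral_indic_ball_le x r0 M0).
apply: ge0_le_integral => //.
- by move=> y _; rewrite lee_fin.
- exact/measurable_EFinP.
- move=> y _; rewrite lee_fin indic_ball.
  by have [xy|xy] := ltP; rewrite ?mulr1// fz// mulr0.
Qed.

(** A real-valued integral is the [fine] of the extended one, hence 0 by default when the latter is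
    infinite; the bound [M] excludes that case. *)
Lemma EFin_Rintegral (f : X -> R) (M : R) : (forall y, 0 <= f y) ->
  (\int[m]_y (f y)%:E <= M%:E)%E -> (\int[m]_y f y)%:E = (\int[m]_y (f y)%:E)%E.
Proof.
move=> f0 fM; rewrite fineK// ge0_fin_numE ?(le_lt_trans fM) ?ltry//.
by apply: integral_ge0 => y _; rewrite lee_fin.
Qed.

Lemma Rintegral_supp_ball (f : X -> R) (x : X) (r M : R) : 0 < r -> 0 <= M ->
  measurable_fun setT f ->
  (forall y, 0 <= f y) -> (forall y, f y <= M) -> (forall y, r <= mdist x y -> f y = 0) ->
  (\int[m]_y f y)%:E = (\int[m]_y (f y)%:E)%E /\ \int[m]_y f y <= M * (c * r `^ N).
Proof.
move=> r0 M0 mf f0 fM fz; have le := integral_supp_ball_le r0 M0 mf f0 fM fz.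
by have E := EFin_Rintegral f0 le; rewrite -lee_fin E.
Qed.

(** * Size, support and Lipschitz bounds at a fixed scale t *)

Section scale.
Variable t : R.
Hypothesis t0 : 0 < t.

Let tN0 : 0 < t `^ N. Proof. by rewrite powR_gt0. Qed.

Let measurable_bump1 x : measurable_fun [set: X] (fun y => h (mdist x y / t)).
Proof. exact: (measurable_bump (T := X) (u := cst x) (v := id) (t := cst t)). Qed.

Let bump_far (x y : X) : 2 * t <= mdist x y -> h (mdist x y / t) = 0.
Proof. by move=> xy; rewrite (bump_zero hh)// ler_pdivlMr. Qed.

Let ball_bE : c * (2 * t) `^ N = b * t `^ N.
Proof. by rewrite bE powRM ?mulrA// ltW. Qed.

Lemma bump_integral_le (f : X -> R) (x : X) (q : R) : 0 <= q ->
  measurable_fun setT f -> (forall y, 0 <= f y) -> (forall y, f y <= q) ->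
  (\int[m]_y (h (mdist x y / t) * f y))%:E = (\int[m]_y (h (mdist x y / t) * f y)%:E)%E
  /\ \int[m]_y (h (mdist x y / t) * f y) <= q * b * t `^ N.
Proof.
move=> q0 mf f0 fq; rewrite -mulrA -ball_bE.
apply: (@Rintegral_supp_ball _ x) => //; first by rewrite mulr_gt0.
- exact: measurable_funM.
- by move=> y; rewrite mulr_ge0.
- by move=> y; rewrite -[leRHS]mul1r ler_pM// (bump_le1 hh).
- by move=> y xy; rewrite bump_far ?mul0r.
Qed.

(** The bump lies between the indicators of the balls of radii t / 2 and 2t. The general bounds p
    and q serve twice: for f = 1, which bounds [phi], and then for f = [phi], which bounds [psi]. *)
Lemma avg_op_bounds (f : X -> R) (x : X) (p q : R) : 0 <= p ->
  measurable_fun setT f -> (forall y, p <= f y) -> (forall y, f y <= q) ->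
  p * a <= avg_op t f x <= q * b.
Proof.
move=> p0 mf pf fq.
have f0 y : 0 <= f y by rewrite (le_trans p0).
have q0 : 0 <= q by rewrite (le_trans (f0 point)).
have [E le] := bump_integral_le x q0 mf f0 fq.
rewrite /Defs.avg_op powRN; apply/andP; split; last first.
  by rewrite mulrC ler_pdivrMr.
rewrite [leRHS]mulrC ler_pdivlMr// -lee_fin E.
have t20 : 0 < 2^-1 * t by rewrite mulr_gt0.
apply: (@le_trans _ _ (\int[m]_y (p * \1_(ball x (2^-1 * t)) y)%:E)%E).
  rewrite integral_indic_ball// -mulrA EFinM lee_wpmul2l ?lee_fin//.
  have /andP[+ _] := reg x t20.
  by rewrite aE powRM ?(ltW t0)// mulrA.
apply: ge0_le_integral => //.
- by move=> y _; rewrite lee_fin mulr_ge0.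
- by apply/measurable_EFinP; exact: measurable_funM.
- move=> y _; rewrite lee_fin indic_ball; have [xy|xy] := ltP.
    by rewrite (bump_one hh) ?mulr1 ?mul1r// ler_pdivrMr// ltW.
  by rewrite mulr0 mulr_ge0.
Qed.

Lemma avg_op1_bounds x : a <= avg_op t (cst 1) x <= b.
Proof. by have := @avg_op_bounds (cst 1) x 1 1; rewrite !mul1r; apply. Qed.

Lemma phi_bounds x : b^-1 <= phi x t <= a^-1.
Proof.
have /andP[l u] := avg_op1_bounds x.
by rewrite /Defs.phi !lef_pV2 ?posrE ?l ?u// (lt_le_trans a0).
Qed.

Lemma psi_le x : psi x t <= b / a.
Proof.
have /andP[l _] : b^-1 * a <= avg_op t (fun y => phi y t) x <= a^-1 * b.
  apply: avg_op_bounds.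
  - by rewrite invr_ge0 ltW.
  - exact: (measurable_phi (T := X) (u := id) (t := cst t)).
  - by move=> y; have /andP[] := phi_bounds y.
  - by move=> y; have /andP[] := phi_bounds y.
have -> : b / a = (b^-1 * a)^-1 by rewrite invfM invrK.
have l0 : 0 < b^-1 * a by rewrite mulr_gt0 ?invr_gt0.
by rewrite lef_pV2 ?posrE// (lt_le_trans l0).
Qed.

Let measurable_psi1 : measurable_fun [set: X] (fun y => psi y t).
Proof. exact: (measurable_psi (T := X) (u := id) (t := cst t)). Qed.

(** Grouping the second bump with [psi] turns the overlap into a bump integral at x of a function
    with values between 0 and [b / a], the setting of [bump_integral_le] and [bump_integral_lip]. *)
Let overlap (x y : X) := \int[m]_z (h (mdist x z / t) * (h (mdist y z / t) * psi z t)).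

Let measurable_hpsi (y : X) : measurable_fun [set: X] (fun z => h (mdist y z / t) * psi z t).
Proof. exact: measurable_funM. Qed.

Let hpsi_ge0 (y z : X) : 0 <= h (mdist y z / t) * psi z t.
Proof. by rewrite mulr_ge0// psi_ge0. Qed.

Let hpsi_le (y z : X) : h (mdist y z / t) * psi z t <= b / a.
Proof. by rewrite -[leRHS]mul1r ler_pM ?psi_ge0 ?psi_le ?(bump_le1 hh). Qed.

Let ba0 : 0 <= b / a. Proof. by rewrite divr_ge0// ltW. Qed.

Let overlap_ge0 (x y : X) : 0 <= overlap x y.
Proof. by apply: Rintegral_ge0 => z _; rewrite mulr_ge0. Qed.

Let overlap_le (x y : X) : overlap x y <= b / a * b * t `^ N.
Proof. by have [] := bump_integral_le x ba0 (measurable_hpsi y) (hpsi_ge0 y) (hpsi_le y). Qed.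

Let s_kernelE (x y : X) : s_kernel x y t = phi x t * phi y t / (t `^ N) ^+ 2 * overlap x y.
Proof.
rewrite /Defs.s_kernel mulrDl mul1r powRD ?(gt_eqF t0) ?implybT//; congr (_ * _).
by apply: eq_Rintegral => z _; rewrite mulrA.
Qed.

Lemma s_kernel_far (x y : X) : 4 * t <= mdist x y -> s_kernel x y t = 0.
Proof.
move=> xy; rewrite s_kernelE (_ : overlap x y = 0) ?mulr0//.
rewrite /overlap /Rintegral (_ : (fun _ => _) = cst 0%E) ?integral0//.
apply/funext => z; congr EFin.
have [xz|xz] := leP (2 * t) (mdist x z); first by rewrite bump_far ?mul0r.
rewrite [h (mdist y z / t)]bump_far ?mul0r ?mulr0//.
have := metric_triangle x z y; rewrite (metric_sym z y); lra.
Qed.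

Let phi_le x : phi x t <= a^-1. Proof. by have /andP[] := phi_bounds x. Qed.

Let ai0 : 0 < a^-1. Proof. by rewrite invr_gt0. Qed.

Lemma s_kernel_le (x y : X) : s_kernel x y t <= a^-1 * a^-1 * (b / a * b) / t `^ N.
Proof.
rewrite s_kernelE.
have -> : a^-1 * a^-1 * (b / a * b) / t `^ N =
    a^-1 * a^-1 / (t `^ N) ^+ 2 * (b / a * b * t `^ N).
  by field; rewrite !gt_eqF.
rewrite ler_pM//; first by rewrite divr_ge0 ?sqr_ge0// mulr_ge0 ?phi_ge0.
by rewrite ler_pM2r ?invr_gt0 ?exprn_gt0// ler_pM ?phi_ge0.
Qed.

Lemma bump_integral_lip (f : X -> R) (x y : X) (q : R) : 0 <= q ->
  measurable_fun setT f -> (forall z, 0 <= f z) -> (forall z, f z <= q) ->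
  `|\int[m]_z (h (mdist x z / t) * f z) - \int[m]_z (h (mdist y z / t) * f z)| <=
  L * (mdist x y / t) * (q * b * t `^ N).
Proof.
move=> q0 mf f0 fq.
have L0 : 0 <= L.
  have := le_trans (normr_ge0 _) (bump_lip hh 0 1).
  by rewrite sub0r normrN normr1 mulr1.
(* One inequality suffices by symmetry. It follows from a pointwise bound in which the Lipschitz
   error is charged only on the ball of radius 2t about x': outside it the left-hand bump
   vanishes. *)
suff H (x' y' : X) : \int[m]_z (h (mdist x' z / t) * f z) <= \int[m]_z (h (mdist y' z / t) * f z) +
    L * (mdist x' y' / t) * (q * b * t `^ N).
  rewrite ler_distl; have := H x y; have := H y x; rewrite (metric_sym y x); lra.
have [Ex _] := bump_integral_le x' q0 mf f0 fq.
have [Ey _] := bump_integral_le y' q0 mf f0 fq.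
have t20 : 0 < 2 * t by rewrite mulr_gt0.
have M0 : 0 <= L * (mdist x' y' / t) * q.
  by rewrite !mulr_ge0 ?invr_ge0 ?mdist_ge0// ltW.
rewrite -lee_fin EFinD Ex Ey.
apply: (@le_trans _ _ (\int[m]_z (h (mdist y' z / t) * f z)%:E +
    \int[m]_z (L * (mdist x' y' / t) * q * \1_(ball x' (2 * t)) z)%:E)%E); last first.
  rewrite leeD2l// (le_trans (integral_indic_ball_le x' t20 M0))//.
  by rewrite ball_bE lee_fin !mulrA.
have mhf (w : X) : measurable_fun [set: X] (fun z => (h (mdist w z / t) * f z)%:E).
  by apply/measurable_EFinP; exact: measurable_funM.
rewrite -ge0_integralD//; last 2 first.
  - by move=> z _; rewrite lee_fin mulr_ge0.
  - by move=> z _; rewrite lee_fin mulr_ge0.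
apply: ge0_le_integral => //.
- by move=> z _; rewrite lee_fin mulr_ge0.
- exact: emeasurable_funD.
- move=> z _; rewrite -EFinD lee_fin indic_ball; have [xz|xz] := ltP; last first.
    by rewrite bump_far// mul0r mulr0 addr0 mulr_ge0.
  rewrite mulr1.
  apply: (@le_trans _ _ ((h (mdist y' z / t) + L * (mdist x' y' / t)) * f z)).
    rewrite ler_wpM2r//.
    have := bump_lip hh (mdist x' z / t) (mdist y' z / t); rewrite -mulrBl normrM.
    rewrite [`|t^-1|]gtr0_norm ?invr_gt0// ler_distl => /andP[_ /le_trans]; apply.
    rewrite lerD2l ler_wpM2l// ler_pM2r ?invr_gt0// ler_distl.
    have := metric_triangle x' y' z; have := metric_triangle y' x' z.
    rewrite (metric_sym y' x'); lra.
  by rewrite mulrDl lerD2l ler_wpM2l// mulr_ge0// divr_ge0 ?mdist_ge0// ltW.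
Qed.

(** A difference of reciprocals is the product of the reciprocals times the reversed difference, and
    T_t 1 is Lipschitz by [bump_integral_lip] with f = 1. *)
Lemma phi_lip (x y : X) : `|phi x t - phi y t| <= a^-1 * a^-1 * (L * (mdist x y / t) * b).
Proof.
have /andP[ax _] := avg_op1_bounds x; have /andP[ay _] := avg_op1_bounds y.
have x0 := lt_le_trans a0 ax; have y0 := lt_le_trans a0 ay.
have -> : phi x t - phi y t = phi x t * phi y t * (avg_op t (cst 1) y - avg_op t (cst 1) x).
  by rewrite /Defs.phi; field; rewrite !gt_eqF.
rewrite normrM ger0_norm ?mulr_ge0 ?phi_ge0// ler_pM ?mulr_ge0 ?phi_ge0//.
  by rewrite ler_pM ?phi_ge0.
rewrite /Defs.avg_op -mulrBr normrM powRN ger0_norm ?invr_ge0 ?(ltW tN0)//.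
rewrite [leLHS]mulrC ler_pdivrMr//.
rewrite -[leRHS]mulrA -[in leRHS](mul1r b) distrC; exact: bump_integral_lip.
Qed.

Lemma s_kernel_lip (x y z : X) : `|s_kernel x z t - s_kernel y z t| <=
  L * (a^-1 ^+ 4 * b ^+ 3 + a^-1 ^+ 3 * b ^+ 2) * (mdist x y / t) / t `^ N.
Proof.
rewrite !s_kernelE.
set D := mdist x y / t; set T := t `^ N.
(* Product rule in x: varying [phi] gives the coefficient [a^-1 ^+ 4 * b ^+ 3], varying the overlap
   gives [a^-1 ^+ 3 * b ^+ 2]. *)
have -> : phi x t * phi z t / T ^+ 2 * overlap x z - phi y t * phi z t / T ^+ 2 * overlap y z =
  (phi x t - phi y t) * (phi z t / T ^+ 2 * overlap x z) +
  phi y t * phi z t / T ^+ 2 * (overlap x z - overlap y z) by ring.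
have T2 : 0 <= (T ^+ 2)^-1 by rewrite invr_ge0 sqr_ge0.
apply: (@le_trans _ _ (a^-1 * a^-1 * (L * D * b) * (a^-1 / T ^+ 2 * (b / a * b * T)) +
  a^-1 * a^-1 / T ^+ 2 * (L * D * (b / a * b * T)))); last first.
  rewrite le_eqVlt; apply/orP; left; apply/eqP; field.
  by rewrite !gt_eqF.
rewrite (le_trans (ler_normD _ _))// lerD// normrM.
  rewrite ler_pM// ?phi_lip// ger0_norm ?mulr_ge0 ?phi_ge0//.
  by rewrite ler_pM ?mulr_ge0 ?phi_ge0// ler_wpM2r.
rewrite ler_pM//; last exact: bump_integral_lip.
by rewrite ger0_norm ?mulr_ge0 ?phi_ge0// ler_wpM2r// ler_pM ?phi_ge0.
Qed.

Lemma integral_s_kernel_le x :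
  (\int[m]_y (s_kernel x y t)%:E <= (a^-1 * a^-1 * (b / a * b) * (c * 4 `^ N))%:E)%E.
Proof.
set K := a^-1 * a^-1 * (b / a * b); have K0 : 0 <= K by rewrite !mulr_ge0// ltW.
have := @integral_supp_ball_le (fun y => s_kernel x y t) x (4 * t) (K / t `^ N).
have -> : K / t `^ N * (c * (4 * t) `^ N) = K * (c * 4 `^ N).
  by rewrite powRM ?(ltW t0)//; field; rewrite gt_eqF.
apply => //; first by rewrite mulr_gt0.
- by rewrite divr_ge0// ltW.
- exact: (measurable_s_kernel (T := X) (u := cst x) (v := id) (t := cst t)).
- by move=> y; exact: s_kernel_ge0.
- by move=> y; exact: s_kernel_le.
- by move=> y; exact: s_kernel_far.
Qed.

End scale.

Lemma integral_s_kernel_dist_le : exists2 K : R, 0 <= K & forall t, 0 < t -> forall x y : X,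
  (\int[m]_z (`|s_kernel x z t - s_kernel y z t|)%:E <=
     (K * Num.min 1 (mdist x y / t))%:E)%E.
Proof.
pose Cs := a^-1 * a^-1 * (b / a * b).
pose Cl := L * (a^-1 ^+ 4 * b ^+ 3 + a^-1 ^+ 3 * b ^+ 2).
have Cs0 : 0 <= Cs by rewrite !mulr_ge0 ?invr_ge0// ltW.
(* [Cs] comes from the size bound and [Cl] from the Lipschitz bound; the minimum with 1 selects the
   better one. The factors [4 ^ N] and 2 account for the two balls of radius 4t about x and y,
   outside which both kernels vanish. *)
exists ((Cs + `|Cl|) * (c * 4 `^ N) * 2).
  by rewrite !mulr_ge0 ?powR_ge0 ?addr_ge0// ltW.
move=> t t0 x y.
have tN0 : 0 < t `^ N by rewrite powR_gt0.
set D := Num.min 1 _.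
have D0 : 0 <= D by rewrite le_min ler01 divr_ge0 ?mdist_ge0// ltW.
pose K := (Cs + `|Cl|) * D / t `^ N.
have K0 : 0 <= K by rewrite !mulr_ge0 ?addr_ge0 ?invr_ge0// ltW.
have t40 : 0 < 4 * t by rewrite mulr_gt0.
apply: (@le_trans _ _ (\int[m]_z (K * \1_(ball x (4 * t)) z)%:E +
    \int[m]_z (K * \1_(ball y (4 * t)) z)%:E)%E); last first.
  apply: (le_trans (leeD (integral_indic_ball_le x t40 K0) (integral_indic_ball_le y t40 K0))).
  rewrite -EFinD lee_fin powRM ?(ltW t0)// /K le_eqVlt; apply/orP; left; apply/eqP; field.
  by rewrite gt_eqF.
rewrite -ge0_integralD//; last 2 first.
  - by move=> z _; rewrite lee_fin mulr_ge0.
  - by move=> z _; rewrite lee_fin mulr_ge0.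
apply: ge0_le_integral => //.
- apply/measurable_EFinP; apply: (@measurableT_comp _ _ _ _ _ _ (@Num.norm _ R)) => //.
  apply: measurable_funB.
    exact: (measurable_s_kernel (T := X) (u := cst x) (v := id) (t := cst t)).
  exact: (measurable_s_kernel (T := X) (u := cst y) (v := id) (t := cst t)).
- exact: emeasurable_funD.
move=> z _; rewrite -EFinD lee_fin !indic_ball.
have sK : `|s_kernel x z t - s_kernel y z t| <= K.
  have sl := s_kernel_lip t0 x y z.
  have sx := s_kernel_le t0 x z; have sy := s_kernel_le t0 y z.
  have sx0 := s_kernel_ge0 x z t; have sy0 := s_kernel_ge0 y z t.
  have Cs1 : Cs / t `^ N <= (Cs + `|Cl|) / t `^ N.
    by rewrite ler_pM2r ?invr_gt0// lerDl.
  rewrite /K /D; have [_|_] := leP 1 (mdist x y / t).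
    by rewrite mulr1 ler_norml; move: sx sy; rewrite -/Cs; lra.
  rewrite (le_trans sl)// -/Cl ler_pM2r ?invr_gt0// ler_wpM2r//.
    by rewrite divr_ge0 ?mdist_ge0// ltW.
  by rewrite (le_trans (ler_norm _))// lerDr.
have [xz|xz] := leP (4 * t) (mdist x z); have [yz|yz] := leP (4 * t) (mdist y z).
- by rewrite !s_kernel_far// subrr normr0 !mulr0 addr0.
all: by apply: (le_trans sK); rewrite ?mulr1 ?mulr0 ?addr0 ?add0r ?lerDl.
Qed.

End kernel.

(** * The weight in the scale variable *)

Section power_integrals.
Context (R : realType).
Local Notation mu := (@lebesgue_measure R).

Lemma powR_continuous_at (e x : R) : 0 < x -> {for x, continuous (@powR R ^~ e)}.
Proof.
move=> x0; apply: differentiable_continuous; apply/derivable1_diffP.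
by apply: derivable_powR; rewrite in_itv/= x0.
Qed.

Lemma integral_powR_segment (e x y : R) : e != 0 -> 0 < x -> x < y ->
  (\int[mu]_(t in `[x, y]) (t `^ (e - 1))%:E = ((y `^ e - x `^ e) / e)%:E)%E.
Proof.
move=> e0 x0 xy.
have dF z : 0 < z -> derivable (fun t => e^-1 * t `^ e) z 1.
  move=> z0; apply: derivableM => //.
  by apply: derivable_powR; rewrite in_itv/= z0.
have cF z : 0 < z -> {for z, continuous (fun t => e^-1 * t `^ e)}.
  by move=> z0; apply: differentiable_continuous; apply/derivable1_diffP; exact: dF.
rewrite (@continuous_FTC2 _ _ (fun t => e^-1 * t `^ e))//.
- by rewrite -EFinB -mulrBr mulrC.
- apply: continuous_in_subspaceT => z; rewrite inE/= in_itv/= => /andP[xz _].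
  by apply: powR_continuous_at; rewrite (lt_le_trans x0).
- split.
  + by move=> z; rewrite in_itv/= => /andP[xz _]; apply: dF; rewrite (lt_trans x0).
  + by apply: cvg_at_right_filter; exact: cF.
  + by apply: cvg_at_left_filter; apply: cF; rewrite (lt_trans x0).
- move=> z; rewrite in_itv/= => /andP[xz _]; have z0 := lt_trans x0 xz.
  rewrite derive1Ml ?powR_derive1 ?in_itv/= ?z0//.
    by rewrite mulrA mulVf// mul1r.
  by apply: derivable_powR; rewrite in_itv/= z0.
Qed.

(** Improper integrals are reached from compact segments, where the fundamental theorem of calculus
    applies, by monotone convergence. *)
Lemma integral_powR_bigcup_le (e M : R) (F : nat -> set R) :
  {homo F : n k / (n <= k)%N >-> (n <= k)%O} -> (forall n, measurable (F n)) ->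
  (forall n, (\int[mu]_(t in F n) (t `^ (e - 1))%:E <= M%:E)%E) ->
  (\int[mu]_(t in \bigcup_n F n) (t `^ (e - 1))%:E <= M%:E)%E.
Proof.
move=> ndF mF FM.
have /cvg_lim cvgF : (\int[mu]_(t in F n) (t `^ (e - 1))%:E @[n --> \oo] -->
    \int[mu]_(t in \bigcup_n F n) (t `^ (e - 1))%:E)%E.
  apply: ge0_nondecreasing_set_cvg_integral => //.
  - move=> n; apply/measurable_EFinP; apply: measurable_funTS.
    exact: measurable_powR.
  - by move=> n x _; rewrite lee_fin powR_ge0.
rewrite -cvgF//; apply: lime_le; last by apply: nearW => n; exact: FM.
apply: ereal_nondecreasing_is_cvgn => n k nk.
apply: ge0_subset_integral.
- exact: mF.
- exact: mF.
- by apply/measurable_EFinP; apply: measurable_funTS; exact: measurable_powR.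
- by move=> x _; rewrite lee_fin powR_ge0.
- by apply/subsetPset/ndF.
Qed.

Lemma integral_powR_near0_le (e x : R) : 0 < e -> 0 < x ->
  (\int[mu]_(t in `]0%R, x]) (t `^ (e - 1))%:E <= (x `^ e / e)%:E)%E.
Proof.
move=> e0 x0.
(* With n + 2 in the denominator every segment is nondegenerate, as [integral_powR_segment]
   requires. *)
have -> : [set` `]0, x]] = \bigcup_n [set` `[x / n.+2%:R, x]].
  apply/seteqP; split => [t|t [n _]]/=; rewrite !in_itv/=.
    move=> /andP[t0 tx]; exists (Num.truncn (x / t)) => //=; rewrite in_itv/= tx andbT.
    rewrite ler_pdivrMr// mulrC -ler_pdivrMr// ltW// (lt_le_trans (truncnS_gt _))//.
    by rewrite ler_nat.
  by move=> /andP[+ ->]; rewrite andbT; apply: lt_le_trans; rewrite divr_gt0.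
apply: integral_powR_bigcup_le => [n k nk|//|n].
  apply/subsetPset => t; rewrite /= !in_itv/= => /andP[+ ->]; rewrite andbT.
  by apply: le_trans; rewrite ler_pM2l// lef_pV2 ?posrE// ler_nat !ltnS.
rewrite integral_powR_segment ?gt_eqF ?divr_gt0//; last first.
  by rewrite ltr_pdivrMr// ltr_pMr// ltr1n.
by rewrite lee_fin ler_pM2r ?invr_gt0// gerBl powR_ge0.
Qed.

Lemma integral_powR_infty_le (e x : R) : 0 < e -> 0 < x ->
  (\int[mu]_(t in `]x, +oo[) (t `^ (- e - 1))%:E <= (x `^ (- e) / e)%:E)%E.
Proof.
move=> e0 x0.
have sub : [set` `]x, +oo[] `<=` \bigcup_n [set` `[x, x + n.+1%:R]].
  move=> t /=; rewrite in_itv/= andbT => xt.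
  exists (Num.truncn (t - x)) => //=; rewrite in_itv/= (ltW xt)/=.
  by rewrite -lerBlDl ltW// truncnS_gt.
apply: (le_trans (ge0_subset_integral mu _ _ _ _ sub)) => //.
- exact: bigcup_measurable.
- by apply/measurable_EFinP; apply: measurable_funTS; exact: measurable_powR.
- by move=> t _; rewrite lee_fin powR_ge0.
apply: integral_powR_bigcup_le => [n k nk|//|n].
  apply/subsetPset => t; rewrite /= !in_itv/= => /andP[->]/=.
  by move=> /le_trans; apply; rewrite lerD2l ler_nat.
rewrite integral_powR_segment ?oppr_eq0 ?gt_eqF ?ltrDl//.
by rewrite lee_fin invrN mulrN -mulNr ler_pM2r ?invr_gt0// opprB gerBl powR_ge0.
Qed.

End power_integrals.

(** * Bounds on the weight and its integrals *)

Section weight.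
Context (R : realType).
Local Notation mu := (@lebesgue_measure R).
Variable alpha : R.
Hypothesis alpha0 : 0 < alpha.

Definition bessel_weight (t : R) : R := t `^ alpha / (1 + t `^ alpha) ^+ 2 / t.

Let w := bessel_weight.

Lemma measurable_bessel_weight : measurable_fun setT bessel_weight.
Proof.
apply: measurable_funM; last exact: measurable_funV.
apply: measurable_funM; first exact: measurable_powR.
by apply: measurable_funV; apply: measurable_funX; exact: measurable_funD.
Qed.

Let d0 (t : R) : 0 < (1 + t `^ alpha) ^+ 2.
Proof. by rewrite exprn_gt0// ltr_pwDl// powR_ge0. Qed.

Lemma bessel_weight_ge0 t : 0 < t -> 0 <= w t.
Proof. by move=> t0; rewrite !divr_ge0 ?powR_ge0// ltW. Qed.

(** Write t^alpha as t^beta t^(alpha - beta); the second factor is at most 1 for t <= 1 and at most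
    t^alpha for t > 1, hence always at most 1 + t^alpha, which its square dominates. *)
Lemma bessel_weight_le beta t : 0 <= beta -> beta <= alpha -> 0 < t ->
  w t <= t `^ (beta - 1).
Proof.
move=> b0 ba t0; rewrite powRB ?(gt_eqF t0) ?implybT// powRr1 ?(ltW t0)//.
rewrite ler_pM2r ?invr_gt0// ler_pdivrMr//.
have tb : t `^ alpha = t `^ beta * t `^ (alpha - beta).
  by rewrite -powRD ?(gt_eqF t0) ?implybT// addrC subrK.
have tab : t `^ (alpha - beta) <= 1 + t `^ alpha.
  have ? := powR_ge0 t alpha.
  have [t1|t1] := leP t 1.
    apply: (@le_trans _ _ 1); last by rewrite lerDl.
    have -> : 1 = 1 `^ (alpha - beta) :> R by rewrite powR1.
    by rewrite ge0_ler_powR ?nnegrE ?subr_ge0// ltW.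
  apply: (@le_trans _ _ (t `^ alpha)); last by rewrite lerDr.
  by rewrite ler_powR ?(ltW t1)// gerBl.
rewrite [leLHS]tb ler_wpM2l ?powR_ge0// (le_trans tab)// expr2 ler_peMr//.
  by rewrite addr_ge0// powR_ge0.
by rewrite lerDl powR_ge0.
Qed.

(** Comes from t^(2 alpha) <= (1 + t^alpha)^2. It gives integrability at infinity, while
    [bessel_weight_le] with beta = alpha gives it at 0. *)
Lemma bessel_weight_le_infty t : 0 < t -> w t <= t `^ (- alpha - 1).
Proof.
move=> t0; rewrite powRB ?(gt_eqF t0) ?implybT// powRr1 ?(ltW t0)//.
rewrite ler_pM2r ?invr_gt0// ler_pdivrMr// powRN mulrC ler_pdivlMr ?powR_gt0//.
rewrite -expr2 lerXn2r ?nnegrE ?powR_ge0//.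
  by rewrite addr_ge0// powR_ge0.
by rewrite lerDr.
Qed.

Lemma integral_split_le (f : R -> R) (x A B : R) : 0 < x -> measurable_fun setT f ->
  (forall t, 0 < t -> 0 <= f t) ->
  (\int[mu]_(t in `]0%R, x]) (f t)%:E <= A%:E)%E ->
  (\int[mu]_(t in `]x, +oo[) (f t)%:E <= B%:E)%E ->
  (\int[mu]_(t in `]0%R, +oo[) (f t)%:E <= (A + B)%:E)%E.
Proof.
move=> x0 mf f0 fA fB.
have -> : [set` `]0, +oo[] = [set` `]0, x]] `|` [set` `]x, +oo[].
  apply/seteqP; split => t /=; rewrite !in_itv/= !andbT.
    by move=> t0; have [tx|tx] := leP t x; [left|right] => //; rewrite t0.
  by case=> [/andP[]//|]; apply: lt_trans.
rewrite ge0_integral_setU//.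
- by rewrite EFinD leeD.
- by apply/measurable_EFinP; exact: measurable_funTS.
- move=> t /=; rewrite !in_itv/= !andbT lee_fin.
  by case=> [/andP[? _]|xt]; apply: f0 => //; exact: lt_trans xt.
- rewrite disj_set2E; apply/eqP/seteqP; split => // t /=; rewrite !in_itv/= andbT.
  by move=> [/andP[_]]; rewrite leNgt => /negP.
Qed.

Lemma integral_bessel_weight_le :
  (\int[mu]_(t in `]0%R, +oo[) (w t)%:E <= (alpha^-1 + alpha^-1)%:E)%E.
Proof.
apply: (@integral_split_le _ 1) => //.
- exact: measurable_bessel_weight.
- exact: bessel_weight_ge0.
- have := integral_powR_near0_le alpha0 (@ltr01 R); rewrite powR1 mul1r; apply: le_trans.
  apply: ge0_le_integral => //.
  + by move=> t /=; rewrite in_itv/= => /andP[t0 _]; rewrite lee_fin bessel_weight_ge0.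
  + by apply/measurable_EFinP; apply: measurable_funTS; exact: measurable_bessel_weight.
  + by apply/measurable_EFinP; apply: measurable_funTS; exact: measurable_powR.
  + move=> t /=; rewrite in_itv/= => /andP[t0 _].
    by rewrite lee_fin bessel_weight_le// ltW.
- have := integral_powR_infty_le alpha0 (@ltr01 R); rewrite powR1 mul1r; apply: le_trans.
  apply: ge0_le_integral => //.
  + move=> t /=; rewrite in_itv/= andbT => t1.
    by rewrite lee_fin bessel_weight_ge0// (lt_trans ltr01).
  + by apply/measurable_EFinP; apply: measurable_funTS; exact: measurable_bessel_weight.
  + by apply/measurable_EFinP; apply: measurable_funTS; exact: measurable_powR.
  + move=> t /=; rewrite in_itv/= andbT => t1.
    by rewrite lee_fin bessel_weight_le_infty// (lt_trans ltr01).
Qed.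

(** Splitting at t = x: below, the minimum is at most 1 and the power t^(beta-1) yields x^beta /
    beta; above, it is at most x / t and x t^(beta-2) yields x^beta / (1 - beta), which is where
    beta < 1 enters. *)
Lemma integral_bessel_weight_min_le beta x : 0 < beta -> beta < 1 -> beta <= alpha -> 0 < x ->
  (\int[mu]_(t in `]0%R, +oo[) (w t * Num.min 1 (x / t))%:E <=
    ((beta^-1 + (1 - beta)^-1) * x `^ beta)%:E)%E.
Proof.
move=> b0 b1 ba x0.
have mwm : measurable_fun setT (fun t : R => w t * Num.min 1 (x / t)).
  apply: measurable_funM; first exact: measurable_bessel_weight.
  by apply: measurable_minr => //; apply: measurable_funM => //; exact: measurable_funV.
have m0 t : 0 < t -> 0 <= Num.min 1 (x / t).
  by move=> t0; rewrite le_min ler01 divr_ge0// ltW.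
have wm0 t : 0 < t -> 0 <= w t * Num.min 1 (x / t).
  by move=> t0; rewrite mulr_ge0 ?bessel_weight_ge0 ?m0.
rewrite mulrDl; apply: (@integral_split_le _ x) => //.
- rewrite mulrC; apply: le_trans (integral_powR_near0_le b0 x0).
  apply: ge0_le_integral => //.
  + by move=> t /=; rewrite in_itv/= => /andP[t0 _]; rewrite lee_fin wm0.
  + by apply/measurable_EFinP; exact: measurable_funTS.
  + by apply/measurable_EFinP; apply: measurable_funTS; exact: measurable_powR.
  + move=> t /=; rewrite in_itv/= => /andP[t0 _].
    rewrite lee_fin -[leRHS]mulr1 ler_pM ?bessel_weight_ge0 ?m0//.
      by rewrite bessel_weight_le// ltW.
    by rewrite ge_min lexx.
- have b10 : 0 < 1 - beta by rewrite subr_gt0.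
  have := integral_powR_infty_le b10 x0.
  have -> : x `^ beta = x * x `^ (- (1 - beta)).
    by rewrite opprB -[X in X * _]powRr1 ?(ltW x0)// -powRD ?(gt_eqF x0) ?implybT// addrC subrK.
  have -> : ((1 - beta)^-1 * (x * x `^ (- (1 - beta))))%:E =
     (x%:E * (x `^ (- (1 - beta)) / (1 - beta))%:E)%E.
    by rewrite -EFinM; congr EFin; ring.
  move=> /(lee_wpmul2l (ltW x0 : (0 <= x%:E)%E)); apply: le_trans.
  rewrite -ge0_integralZl_EFin ?(ltW x0)//; last 2 first.
  + by move=> t _; rewrite lee_fin powR_ge0.
  + by apply/measurable_EFinP; apply: measurable_funTS; exact: measurable_powR.
  apply: ge0_le_integral => //.
  + move=> t /=; rewrite in_itv/= andbT => xt.
    by rewrite lee_fin wm0// (lt_trans x0).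
  + by apply/measurable_EFinP; exact: measurable_funTS.
  + apply: measurable_funeM; apply/measurable_EFinP; apply: measurable_funTS.
    exact: measurable_powR.
  + move=> t /=; rewrite in_itv/= andbT => xt; have t0 := lt_trans x0 xt.
    rewrite -EFinM lee_fin.
    have -> : x * t `^ (- (1 - beta) - 1) = t `^ (beta - 1) * (x / t).
      rewrite opprB [t `^ (beta - 1 - 1)]powRB ?(gt_eqF t0) ?implybT//.
      by rewrite powRr1 ?(ltW t0)//; ring.
    rewrite ler_pM ?bessel_weight_ge0 ?m0//.
      by rewrite bessel_weight_le// ltW.
    by rewrite ge_min lexx orbT.
Qed.

End weight.

(** * The Bessel kernel *)

Section tonelli_half_line.
Context d (T : measurableType d) (R : realType).
Local Notation mu := (@lebesgue_measure R).
Local Open Scope ereal_scope.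
Variable G : T -> R -> \bar R.
Hypothesis mG : measurable_fun setT (fun z : T * R => G z.1 z.2).
Hypothesis G0 : forall z t, (0 < t)%R -> 0 <= G z t.

Let D : set R := [set` `]0%R, +oo[].
(** Extension by 0 from the half-line: the sign of [G] is known only for t > 0, whereas Tonelli is
    applied on all of R. *)
Let H z t := G z t * (\1_D t)%:E.

Let H0 z t : 0 <= H z t.
Proof.
rewrite /H indicE; case: (boolP (t \in D)) => [|_]; last by rewrite mule0.
by rewrite inE /D/= in_itv/= andbT => t0; rewrite mule1 G0.
Qed.

Let mH : measurable_fun setT (fun z : T * R => H z.1 z.2).
Proof.
apply: emeasurable_funM => //; apply/measurable_EFinP.
apply: (@measurableT_comp _ _ _ _ _ _ (\1_D : R -> R)) => //.
by apply: measurable_indic; exact: measurable_itv.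
Qed.

Let GH z : \int[mu]_(t in D) G z t = \int[mu]_t H z t.
Proof.
rewrite integral_mkcond; apply: eq_integral => t _; rewrite patchE /H indicE.
by case: ifPn => _; rewrite ?mule1 ?mule0.
Qed.

Lemma measurable_integral_half_line :
  measurable_fun setT (fun z => \int[mu]_(t in `]0%R, +oo[) G z t).
Proof. by under eq_fun do rewrite GH; exact: measurable_integral_param. Qed.

Variable nu : {sigma_finite_measure set T -> \bar R}.

Let HG t : D t -> \int[nu]_z H z t = \int[nu]_z G z t.
Proof. by move=> Dt; apply: eq_integral => z _; rewrite /H indicE mem_set// mule1. Qed.

Lemma tonelli_half_line :
  measurable_fun (`]0%R, +oo[%classic : set R) (fun t : R => \int[nu]_z G z t) /\
  \int[nu]_z \int[mu]_(t in `]0%R, +oo[) G z t =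
  \int[mu]_(t in `]0%R, +oo[) \int[nu]_z G z t.
Proof.
split.
- apply: (eq_measurable_fun (fun t => \int[nu]_z H z t)).
    by move=> t; rewrite inE => /HG.
  apply: measurable_funTS.
  exact: (measurable_fun_fubini_tonelli_G (m1 := nu) (fun z => H z.1 z.2)).
- under eq_integral do rewrite GH.
  rewrite (fubini_tonelli (m1 := nu) (m2 := mu) (fun z => H z.1 z.2))//=.
  rewrite [RHS]integral_mkcond; apply: eq_integral => t _; rewrite patchE.
  case: ifPn => [|tD]; first by rewrite inE => /HG.
  by apply: integral0_eq => z _; rewrite /H indicE (negbTE tD) mule0.
Qed.

End tonelli_half_line.

Section bessel_kernel.
Context d (R : realType) (X : measurableMetricType d R).
Hypothesis hX : is_borel X.
Variables (m : {sigma_finite_measure set X -> \bar R}) (N c : R).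
Hypothesis c0 : 0 < c.
Hypothesis reg : forall (x : X) (r : R), 0 < r ->
  ((c^-1 * r `^ N)%:E <= m (ball x r) <= (c * r `^ N)%:E)%E.
Variables (h : R -> R) (L : R).
Hypothesis hh : lipschitz_bump h L.
Variable alpha : R.
Hypothesis alpha0 : 0 < alpha.

Local Notation mu := (@lebesgue_measure R).
Local Notation s := (s_kernel m N h).
Local Notation k := (bessel_kernel m N h alpha).
Local Notation w := (bessel_weight alpha).
Local Notation half_line := [set` `]0%R, +oo[].

Let s_ge0 (x y : X) t : 0 <= s x y t. Proof. exact: s_kernel_ge0 hh _ _ _. Qed.

Lemma bessel_kernelE (x y : X) :
  k x y = (alpha%:E * \int[mu]_(t in half_line) (w t * s x y t)%:E)%E.
Proof.
rewrite /bessel_kernel; congr (_ * _)%E; apply: eq_integral => t _.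
by congr EFin; rewrite mulrAC.
Qed.

Lemma bessel_kernel_ge0 (x y : X) : (0 <= k x y)%E.
Proof.
rewrite bessel_kernelE mule_ge0 ?lee_fin ?(ltW alpha0)// integral_ge0// => t.
by rewrite /= in_itv/= andbT => t0; rewrite lee_fin mulr_ge0 ?bessel_weight_ge0.
Qed.

Lemma bessel_kernelC (x y : X) : k x y = k y x.
Proof.
by rewrite !bessel_kernelE; congr (_ * _)%E; apply: eq_integral => t _; rewrite s_kernelC.
Qed.

Let measurable_ws d' (T : measurableType d') (u v : T -> X) (t : T -> R) :
  measurable_fun setT u -> measurable_fun setT v -> measurable_fun setT t ->
  measurable_fun setT (fun z => w (t z) * s (u z) (v z) (t z)).
Proof.
move=> mu_ mv mt; apply: measurable_funM; last exact: (measurable_s_kernel hX c0 reg hh).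
exact: (@measurableT_comp _ _ _ _ _ _ w) (measurable_bessel_weight alpha) _.
Qed.

Lemma measurable_bessel_kernel d' (T : measurableType d') (u v : T -> X) :
  measurable_fun setT u -> measurable_fun setT v ->
  measurable_fun setT (fun z => k (u z) (v z)).
Proof.
move=> mu_ mv; under eq_fun do rewrite bessel_kernelE.
apply: measurable_funeM.
pose H (z : X * X) t := (w t * s z.1 z.2 t)%:E.
apply: (@measurableT_comp _ _ _ _ _ _
  (fun z => \int[mu]_(t in half_line) H z t)%E _ (fun z => (u z, v z))); last exact: measurable_fun_pair.
apply: (measurable_integral_half_line (G := H)).
  apply/measurable_EFinP; apply: measurable_ws => //.
  - exact: (@measurableT_comp _ _ _ _ _ _ fst).
  - exact: (@measurableT_comp _ _ _ _ _ _ snd).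
by move=> z t t0; rewrite lee_fin mulr_ge0 ?bessel_weight_ge0.
Qed.

(** After Tonelli, the mass of [s x _ t] is bounded uniformly in t, its size t^-N being compensated
    by the volume of a ball of radius 4t; there remains the integral of the weight. [K] is strictly
    positive because Schur's test divides by it. *)
Lemma integral_bessel_kernel_le : exists2 K : R, 0 < K & forall x : X,
  (\int[m]_y k x y <= K%:E)%E.
Proof.
have [a aE] : exists a, a = c^-1 * 2^-1 `^ N by eexists.
have [b bE] : exists b, b = c * 2 `^ N by eexists.
have a0 : 0 < a by rewrite aE mulr_gt0 ?invr_gt0// powR_gt0.
have b0 : 0 < b by rewrite bE mulr_gt0// powR_gt0.
pose K := a^-1 * a^-1 * (b / a * b) * (c * 4 `^ N).
have K0 : 0 < K by rewrite !mulr_gt0 ?invr_gt0// powR_gt0.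
exists (alpha * (K * (alpha^-1 + alpha^-1))).
  by rewrite mulr_gt0// mulr_gt0// addr_gt0 ?invr_gt0.
move=> x; under eq_integral do rewrite bessel_kernelE.
have mws : measurable_fun setT (fun z : X * R => (w z.2 * s x z.1 z.2)%:E).
  by apply/measurable_EFinP; exact: measurable_ws.
have ws0 (y : X) (t : R) : 0 < t -> (0 <= (w t * s x y t)%:E)%E.
  by move=> t0; rewrite lee_fin mulr_ge0 ?bessel_weight_ge0.
have mI := measurable_integral_half_line (G := fun y t => (w t * s x y t)%:E) mws ws0.
have [mI' IE] := tonelli_half_line (G := fun y t => (w t * s x y t)%:E) mws ws0 m.
rewrite ge0_integralZl ?lee_fin ?(ltW alpha0)//; last first.
  by move=> y _; apply: integral_ge0 => t; rewrite /= in_itv/= andbT; exact: ws0.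
rewrite EFinM lee_pmul2l// IE.
rewrite EFinM; apply: le_trans (lee_wpmul2l _ (integral_bessel_weight_le alpha0)); last first.
  by rewrite lee_fin ltW.
rewrite -ge0_integralZl_EFin ?(ltW K0)//; last 2 first.
- by move=> t; rewrite /= in_itv/= andbT => t0; rewrite lee_fin bessel_weight_ge0.
- by apply/measurable_EFinP; apply: measurable_funTS; exact: measurable_bessel_weight.
apply: ge0_le_integral => //.
- move=> t; rewrite /= in_itv/= andbT => t0; apply: integral_ge0 => y _; exact: ws0.
- apply: measurable_funeM; apply/measurable_EFinP; apply: measurable_funTS.
  exact: measurable_bessel_weight.
- move=> t; rewrite /= in_itv/= andbT => t0.
  under eq_integral do rewrite EFinM.
  rewrite ge0_integralZl_EFin ?bessel_weight_ge0//; last 2 first.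
  + by move=> y _; rewrite lee_fin.
  + apply/measurable_EFinP.
    exact: (measurable_s_kernel hX c0 reg hh (T := X) (u := cst x) (v := id) (t := cst t)).
  rewrite muleC lee_wpmul2r ?lee_fin ?bessel_weight_ge0//.
  exact: (integral_s_kernel_le hX c0 reg hh aE bE t0 x).
Qed.

(** Tonelli brings the integral over z inside, where [integral_s_kernel_dist_le] bounds the
    variation of s at each scale; the integral of the weight against min(1, d / t) then gives the
    power [beta] of the distance. *)
Lemma integral_bessel_kernel_lip (beta : R) : 0 < beta -> beta < 1 -> beta <= alpha ->
  exists2 K : R, 0 <= K & forall (f : X -> R) (M : R) (x y : X),
    measurable_fun setT f -> (forall z, 0 <= f z) -> (forall z, f z <= M) -> x != y ->
    (\int[m]_z ((f z)%:E * k x z) <=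
     \int[m]_z ((f z)%:E * k y z) + (M * K * mdist x y `^ beta)%:E)%E.
Proof.
move=> b0 b1 ba.
have [K K0 HK] := integral_s_kernel_dist_le hX c0 reg hh erefl erefl.
pose B := beta^-1 + (1 - beta)^-1.
have B0 : 0 <= B by rewrite addr_ge0 ?invr_ge0 ?subr_ge0// ltW.
exists (alpha * (K * B)); first by rewrite mulr_ge0 ?(ltW alpha0)// mulr_ge0.
move=> f M x y mf f0 fM xy.
have xy0 : 0 < mdist x y by rewrite mdist_gt0.
have M0 : 0 <= M by rewrite (le_trans (f0 point)).
pose G (z : X) t := (w t * `|s x z t - s y z t|)%:E.
have mG : measurable_fun setT (fun p : X * R => G p.1 p.2).
  apply/measurable_EFinP; apply: measurable_funM.
    exact: (@measurableT_comp _ _ _ _ _ _ w) (measurable_bessel_weight alpha) _.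
  apply: (@measurableT_comp _ _ _ _ _ _ (@Num.norm _ R)) => //.
  by apply: measurable_funB; exact: (measurable_s_kernel hX c0 reg hh).
have G0 z t : 0 < t -> (0 <= G z t)%E.
  by move=> t0; rewrite lee_fin mulr_ge0 ?bessel_weight_ge0.
have mD := measurable_integral_half_line mG G0.
have [mI IE] := tonelli_half_line mG G0 m.
pose D z := (alpha%:E * \int[mu]_(t in half_line) G z t)%E.
have D0 z : (0 <= D z)%E.
  rewrite mule_ge0 ?lee_fin ?(ltW alpha0)// integral_ge0// => t.
  by rewrite /= in_itv/= andbT; exact: G0.
have mDz : measurable_fun setT D by exact: measurable_funeM.
(* Bounding k x z by k y z + D z, rather than the difference, since k may be
   infinite on the diagonal. *)
have kD z : (k x z <= k y z + D z)%E.
  have ws0 v t : half_line t -> (0 <= (w t * s v z t)%:E)%E.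
    by rewrite /= in_itv/= andbT => t0; rewrite lee_fin mulr_ge0 ?bessel_weight_ge0.
  have Gz0 t : half_line t -> (0 <= G z t)%E by rewrite /= in_itv/= andbT; exact: G0.
  have mws (v : X) : measurable_fun (half_line : set R) (fun t : R => (w t * s v z t)%:E).
    apply/measurable_EFinP; apply: measurable_funTS.
    exact: (measurable_ws (T := R) (u := cst v) (v := cst z) (t := id)).
  have mGz : measurable_fun (half_line : set R) (G z).
    by apply: measurable_funTS; exact: (measurable_fun_pair2 z mG).
  rewrite !bessel_kernelE -ge0_muleDr; last 2 first.
  - by apply: integral_ge0 => t; exact: ws0.
  - exact: integral_ge0.
  rewrite lee_wpmul2l ?lee_fin ?(ltW alpha0)// -ge0_integralD//; last 2 first.
  - exact: ws0.
  - exact: mws.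
  apply: ge0_le_integral => //.
  - exact: ws0.
  - exact: mws.
  - by apply: emeasurable_funD; first exact: mws.
  move=> t; rewrite /= in_itv/= andbT => t0.
  rewrite -EFinD lee_fin -mulrDr ler_wpM2l ?bessel_weight_ge0//.
  by rewrite -lerBlDl ler_norm.
have mk v : measurable_fun setT (fun z => (f z)%:E * k v z)%E.
  apply: emeasurable_funM; first exact/measurable_EFinP.
  exact: (measurable_bessel_kernel (T := X) (u := cst v) (v := id)).
have fk0 v z : (0 <= (f z)%:E * k v z)%E by rewrite mule_ge0 ?lee_fin ?bessel_kernel_ge0.
apply: (@le_trans _ _ (\int[m]_z ((f z)%:E * k y z + M%:E * D z))%E).
  apply: ge0_le_integral => //.
  - by apply: emeasurable_funD => //; exact: measurable_funeM.
  - move=> z _; apply: (@le_trans _ _ ((f z)%:E * (k y z + D z))%E).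
      by rewrite lee_wpmul2l ?lee_fin.
    by rewrite ge0_muleDr ?bessel_kernel_ge0// leeD2l// lee_wpmul2r// lee_fin.
rewrite ge0_integralD//; last 2 first.
- by move=> z _; rewrite mule_ge0 ?lee_fin.
- exact: measurable_funeM.
rewrite leeD2l// ge0_integralZl ?lee_fin// -mulrA EFinM lee_wpmul2l ?lee_fin//.
rewrite ge0_integralZl ?lee_fin ?(ltW alpha0)//; last first.
  by move=> z _; apply: integral_ge0 => t; rewrite /= in_itv/= andbT; exact: G0.
rewrite -mulrA EFinM lee_pmul2l// IE -mulrA EFinM.
have := integral_bessel_weight_min_le b0 b1 ba xy0; rewrite -/B.
move=> /(lee_wpmul2l (K0 : (0 <= K%:E)%E)); apply: le_trans.
have mwm : measurable_fun (half_line : set R) (fun t : R => w t * Num.min 1 (mdist x y / t)).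
  apply: measurable_funTS.
  apply: measurable_funM; first exact: measurable_bessel_weight.
  by apply: measurable_minr => //; apply: measurable_funM => //; exact: measurable_funV.
have wm0 t : 0 < t -> 0 <= w t * Num.min 1 (mdist x y / t).
  by move=> t0; rewrite mulr_ge0 ?bessel_weight_ge0// le_min ler01 divr_ge0// ltW.
rewrite -ge0_integralZl_EFin//; last 2 first.
- by move=> t; rewrite /= in_itv/= andbT => t0; rewrite lee_fin wm0.
- exact/measurable_EFinP.
apply: ge0_le_integral => //.
- move=> t; rewrite /= in_itv/= andbT => t0; apply: integral_ge0 => z _; exact: G0.
- by apply: measurable_funeM; exact/measurable_EFinP.
- move=> t; rewrite /= in_itv/= andbT => t0.
  rewrite (_ : (\int[m]_z G z t =
      \int[m]_z ((w t)%:E * (`|s x z t - s y z t|)%:E))%E); last first.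
    by apply: eq_integral => z _; rewrite -EFinM.
  rewrite ge0_integralZl_EFin ?bessel_weight_ge0//; last first.
    apply/measurable_EFinP; apply: (@measurableT_comp _ _ _ _ _ _ (@Num.norm _ R)) => //.
    apply: measurable_funB.
      exact: (measurable_s_kernel hX c0 reg hh (T := X) (u := cst x) (v := id) (t := cst t)).
    exact: (measurable_s_kernel hX c0 reg hh (T := X) (u := cst y) (v := id) (t := cst t)).
  rewrite [in leRHS]EFinM muleCA lee_wpmul2l ?lee_fin ?bessel_weight_ge0//.
  by rewrite -EFinM HK.
Qed.

End bessel_kernel.

(** * Truncation in L^p *)

Section Lnorm_lemmas.
Context d (T : measurableType d) (R : realType) (nu : {measure set T -> \bar R}).
Hypothesis nu0 : (0 < nu setT)%E.
Local Open Scope ereal_scope.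

Lemma Lnorm_EFinE (r : R) (f : T -> \bar R) :
  'N[nu]_r%:E[f] = (\int[nu]_x `|f x| `^ r) `^ r^-1.
Proof. by rewrite unlock. Qed.

(** The norm of exponent +oo is an essential supremum when the total mass is positive, hence the
    hypothesis [nu0]. *)
Lemma Lnorm_yE (f : T -> \bar R) : 'N[nu]_+oo[f] = ess_sup nu (abse \o f).
Proof. by rewrite unlock nu0. Qed.

Lemma measurable_abse_poweR (f : T -> \bar R) (r : R) : measurable_fun setT f ->
  measurable_fun setT (fun x => `|f x| `^ r).
Proof.
move=> mf; apply: (@measurableT_comp _ _ _ _ _ _ (@poweR R ^~ r)).
  exact: measurable_poweR.
exact: measurableT_comp.
Qed.

Lemma ge0_le_poweR (r : R) (x y : \bar R) : (0 <= r)%R -> 0 <= x -> x <= y ->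
  x `^ r <= y `^ r.
Proof.
move=> r0 x0 xy; apply: gt0_ler_poweR => //; rewrite in_itv/= leey andbT//.
exact: le_trans xy.
Qed.

Lemma le_Lnorm (p : \bar R) (f g : T -> \bar R) : 1 <= p ->
  measurable_fun setT f -> measurable_fun setT g ->
  (\forall x \ae nu, `|f x| <= `|g x|) -> 'N[nu]_p[f] <= 'N[nu]_p[g].
Proof.
move=> + mf mg fg; case: p => [r| |]//; last first.
  by move=> _; rewrite !Lnorm_yE; exact: le_ess_sup.
rewrite lee_fin => r1; have r0 : (0 < r)%R by rewrite (lt_le_trans ltr01).
rewrite !Lnorm_EFinE; apply: ge0_le_poweR.
- by rewrite invr_ge0 ltW.
- by apply: integral_ge0 => x _; exact: poweR_ge0.
apply: ae_ge0_le_integral => //.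
- by move=> x _; exact: poweR_ge0.
- exact: measurable_abse_poweR.
- by move=> x _; exact: poweR_ge0.
- exact: measurable_abse_poweR.
- by apply: filterS fg => x fg _; apply: ge0_le_poweR => //; exact: ltW.
Qed.

(** Used to see that the potential of the absolute value of the discarded part of g is finite almost
    everywhere, so that potentials may be subtracted there. *)
Lemma Lnorm_lty_ae (p : \bar R) (f : T -> \bar R) : 1 <= p ->
  measurable_fun setT f -> 'N[nu]_p[f] < +oo -> \forall x \ae nu, `|f x| < +oo.
Proof.
move=> + mf; case: p => [r| |]//; last first.
  move=> _; rewrite Lnorm_yE => foo.
  by apply: filterS (ess_sup_ge nu (abse \o f)) => x /= /le_lt_trans; apply.
rewrite lee_fin => r1; have r0 : (0 < r)%R by rewrite (lt_le_trans ltr01).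
rewrite Lnorm_EFinE => /lty_poweRy; rewrite invr_eq0 gt_eqF// => /(_ isT) foo.
have /integrable_ae : nu.-integrable setT (fun x => `|f x| `^ r).
  apply/integrableP; split; first exact: measurable_abse_poweR.
  by under eq_integral do rewrite gee0_abs ?poweR_ge0//.
move=> /(_ measurableT); apply: filterS => x /(_ I).
rewrite ge0_fin_numE ?poweR_ge0// => /lty_poweRy; apply.
by rewrite gt_eqF.
Qed.

Lemma Lfun_le (p : \bar R) (f g : T -> R) : 1 <= p -> measurable_fun setT f ->
  (forall x, `|f x| <= `|g x|)%R -> g \in Lfun nu p -> f \in Lfun nu p.
Proof.
move=> p1 mf fg gp.
have mg := set_mem (sub_Lfun_mfun gp); have Ng := set_mem (sub_Lfun_finLfun gp).
apply/andP; rewrite !inE; split => //=; apply: le_lt_trans Ng.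
by apply: le_Lnorm => //; [exact/measurable_EFinP|exact/measurable_EFinP|exact: nearW].
Qed.

Lemma LfunE (p : \bar R) (f : T -> R) : f \in Lfun nu p ->
  measurable_fun setT f /\ 'N[nu]_p[EFin \o f] < +oo.
Proof.
move=> fp; split; first exact: set_mem (sub_Lfun_mfun fp).
exact: set_mem (sub_Lfun_finLfun fp).
Qed.

Definition low_part (M : R) (g : T -> R) (x : T) : R := if (`|g x| <= M)%R then g x else 0%R.
Definition high_part (M : R) (g : T -> R) (x : T) : R := if (`|g x| <= M)%R then 0%R else g x.

Let measurable_le (M : R) (g : T -> R) : measurable_fun setT g ->
  measurable_fun setT (fun x => (`|g x| <= M)%R).
Proof.
move=> mg; apply: measurable_fun_ler => //.
by apply: (@measurableT_comp _ _ _ _ _ _ (@Num.norm _ R)).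
Qed.

Lemma measurable_low_part M g : measurable_fun setT g -> measurable_fun setT (low_part M g).
Proof. by move=> mg; apply: measurable_fun_ifT => //; exact: measurable_le. Qed.

Lemma measurable_high_part M g : measurable_fun setT g -> measurable_fun setT (high_part M g).
Proof. by move=> mg; apply: measurable_fun_ifT => //; exact: measurable_le. Qed.

(** For p = +oo a height above the essential supremum leaves a high part that is 0 almost
    everywhere. For finite p, dominated convergence applies: at each point the high part is
    eventually 0, and its r-th power is dominated by that of g. *)
Lemma Lnorm_high_part_lt (p : \bar R) (g : T -> R) (e : R) : 1 <= p -> (0 < e)%R ->
  g \in Lfun nu p -> exists n : nat, 'N[nu]_p[EFin \o high_part n%:R g] < e%:E.
Proof.
move=> + e0 /LfunE[mg]; case: p => [r| |]//; last first.
  move=> _; rewrite Lnorm_yE => gy.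
  have g0 : 0 <= ess_sup nu (abse \o (EFin \o g)) by rewrite -Lnorm_yE; exact: Lnorm_ge0.
  exists (Num.truncn (fine (ess_sup nu (abse \o (EFin \o g))))).+1.
  rewrite Lnorm_yE; apply: (@le_lt_trans _ _ 0); last by rewrite lte_fin.
  apply/ess_supP; apply: filterS (ess_sup_ge nu (abse \o (EFin \o g))) => x /= gx.
  rewrite lee_fin /high_part ifT ?normr0// ltW// (le_lt_trans _ (truncnS_gt _))//.
  by rewrite -lee_fin fineK// ge0_fin_numE.
rewrite lee_fin => r1; have r0 : (0 < r)%R by rewrite (lt_le_trans ltr01).
rewrite Lnorm_EFinE => /lty_poweRy; rewrite invr_eq0 gt_eqF// => /(_ isT) gr.
pose G x := `|(g x)%:E| `^ r.
pose F n x := `|(high_part n%:R g x)%:E| `^ r.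
have iG : nu.-integrable setT G.
  apply/integrableP; split; first by apply: measurable_abse_poweR; exact/measurable_EFinP.
  by under eq_integral do rewrite gee0_abs ?poweR_ge0//.
have mF n : measurable_fun setT (F n).
  by apply: measurable_abse_poweR; apply/measurable_EFinP; exact: measurable_high_part.
have [] := @dominated_convergence _ _ _ nu setT measurableT F (cst 0) G mF.
- exact: measurable_cst.
- apply: nearW => x _; apply: cvg_near_cst; near=> n.
  rewrite /F /high_part ifT ?normr0 ?abse0 ?poweR0r ?gt_eqF//.
  by near: n; exact: nbhs_infty_ger.
- exact: iG.
- apply: nearW => x n _; rewrite gee0_abs ?poweR_ge0//.
  rewrite ge0_le_poweR ?(ltW r0)// !abse_EFin lee_fin /high_part.
  by case: ifPn; rewrite ?normr0.
move=> _ _; rewrite integral0 => F0.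
(* Halving [e] recovers a strict inequality, as [ge0_le_poweR] only gives a large one. *)
have er0 : (0 < (e / 2) `^ r)%R by rewrite powR_gt0// divr_gt0.
have /fine_cvgP[Ffin /cvgr_lt /(_ _ er0) Flt] := F0.
have [n _ /(_ n (leqnn n))/= Fn] : \forall n \near \oo, \int[nu]_x F n x < ((e / 2) `^ r)%:E.
  by near=> n; rewrite -(@fineK _ (\int[nu]_x F n x)) ?lte_fin; near: n.
exists n; rewrite Lnorm_EFinE.
apply: (@le_lt_trans _ _ (e / 2)%:E); last by rewrite lte_fin ltr_pdivrMr// ltr_pMr// ltr1n.
have -> : (e / 2)%:E = (((e / 2) `^ r)%:E) `^ r^-1.
  by rewrite poweR_EFin -powRrM divff ?gt_eqF// powRr1// divr_ge0// ltW.
apply: ge0_le_poweR; first by rewrite invr_ge0 ltW.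
- by apply: integral_ge0 => x _; exact: poweR_ge0.
- exact: ltW.
Unshelve. all: by end_near. Qed.

End Lnorm_lemmas.

(** * Integral operators with nonnegative kernels *)

Section kernel_operator.
Context d (T : measurableType d) (R : realType).
Variable nu : {sigma_finite_measure set T -> \bar R}.
Hypothesis nu0 : (0 < nu setT)%E.
Implicit Types (f : T -> R) (x y z : T) (r M : R) (p : \bar R).
Variables (k : T -> T -> \bar R) (K : R).
Hypothesis mk : measurable_fun setT (fun p : T * T => k p.1 p.2).
Hypothesis k0 : forall x y, (0 <= k x y)%E.
Hypothesis K0 : 0 < K.
Hypothesis kK : forall x, (\int[nu]_y k x y <= K%:E)%E.
Hypothesis kK' : forall y, (\int[nu]_x k x y <= K%:E)%E.

Definition kernel_op (f : T -> R) (x : T) : \bar R := (\int[nu]_z ((f z)%:E * k x z))%E.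

Let measurable_k2 x : measurable_fun setT (k x).
Proof. exact: (measurable_fun_pair2 x mk). Qed.

Let measurable_fk (f : T -> R) x : measurable_fun setT f ->
  measurable_fun setT (fun z => (f z)%:E * k x z)%E.
Proof. by move=> mf; apply: emeasurable_funM => //; exact/measurable_EFinP. Qed.

Let fk_ge0 (f : T -> R) x z : 0 <= f z -> (0 <= (f z)%:E * k x z)%E.
Proof. by move=> f0; rewrite mule_ge0 ?lee_fin. Qed.

Lemma kernel_op_ge0 f x : (forall z, 0 <= f z) -> (0 <= kernel_op f x)%E.
Proof. by move=> f0; apply: integral_ge0 => z _; exact: fk_ge0. Qed.

Let measurable_kernel_op2 (f : T -> R) : measurable_fun setT f ->
  measurable_fun setT (fun p : T * T => (f p.2)%:E * k p.1 p.2)%E.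
Proof.
move=> mf; apply: emeasurable_funM => //; apply/measurable_EFinP.
exact: (@measurableT_comp _ _ _ _ _ _ f).
Qed.

Lemma measurable_kernel_op f : measurable_fun setT f -> (forall z, 0 <= f z) ->
  measurable_fun setT (kernel_op f).
Proof.
move=> mf f0; apply: (@measurable_integral_param _ _ _ nu _ _ (fun x z => (f z)%:E * k x z)%E).
  exact: measurable_kernel_op2.
by move=> x z; exact: fk_ge0.
Qed.

Lemma kernel_op_le_cst f M x : measurable_fun setT f -> (forall z, 0 <= f z) -> 0 <= M ->
  (\forall z \ae nu, f z <= M) -> (kernel_op f x <= (M * K)%:E)%E.
Proof.
move=> mf f0 M0 fM.
apply: (@le_trans _ _ (\int[nu]_z (M%:E * k x z))%E).
  apply: ae_ge0_le_integral => //.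
  - by move=> z _; exact: fk_ge0.
  - exact: measurable_fk.
  - by move=> z _; rewrite mule_ge0 ?lee_fin.
  - exact: measurable_funeM.
  - by apply: filterS fM => z fM _; rewrite lee_wpmul2r// lee_fin.
by rewrite ge0_integralZl ?lee_fin// EFinM lee_wpmul2l ?lee_fin.
Qed.

Lemma integral_kernel_op_le f : measurable_fun setT f -> (forall z, 0 <= f z) ->
  (\int[nu]_x kernel_op f x <= K%:E * \int[nu]_z (f z)%:E)%E.
Proof.
move=> mf f0; rewrite /kernel_op.
rewrite (fubini_tonelli (m1 := nu) (m2 := nu) (fun p : T * T => (f p.2)%:E * k p.1 p.2)%E)/=.
- rewrite -ge0_integralZl ?lee_fin ?(ltW K0)//; last 2 first.
  + exact/measurable_EFinP.
  + by move=> z _; rewrite lee_fin.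
  have mk1 z : measurable_fun setT (k ^~ z) by exact: (measurable_fun_pair1 z mk).
  apply: ge0_le_integral => //.
  + by move=> z _; apply: integral_ge0 => x _; exact: fk_ge0.
  + apply: (measurable_fun_fubini_tonelli_G (m1 := nu)
      (fun p : T * T => (f p.2)%:E * k p.1 p.2)%E); first exact: measurable_kernel_op2.
    by move=> p; exact: fk_ge0.
  + by apply: measurable_funeM; exact/measurable_EFinP.
  + by move=> z _; rewrite ge0_integralZl ?lee_fin// muleC lee_wpmul2r// lee_fin.
- exact: measurable_kernel_op2.
- by move=> p; exact: fk_ge0.
Qed.

(* Splitting f at height s gives f <= s + s^(1 - r) f^r, an elementary substitute
   for Jensen's inequality; s is then optimized. *)
Lemma kernel_op_powR_le f r x : 1 <= r -> measurable_fun setT f -> (forall z, 0 <= f z) ->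
  (kernel_op f x `^ r <= ((2 * K) `^ r / K)%:E * kernel_op (fun z => (f z `^ r)%R) x)%E.
Proof.
move=> r1 mf f0; have r0 : 0 < r by rewrite (lt_le_trans ltr01).
have mfr : measurable_fun setT (fun z => f z `^ r).
  by apply: (@measurableT_comp _ _ _ _ _ _ (@powR R ^~ r)).
have fr0 z : 0 <= f z `^ r by exact: powR_ge0.
have C0 : 0 < (2 * K) `^ r / K by rewrite divr_gt0// powR_gt0// mulr_gt0.
have Fx0 := kernel_op_ge0 x f0.
have := kernel_op_ge0 x fr0.
have key s : 0 < s ->
    (kernel_op f x <= (s * K)%:E + (s `^ (1 - r))%:E * kernel_op (fun z => (f z `^ r)%R) x)%E.
  move=> s0.
  apply: (@le_trans _ _ (\int[nu]_z (s%:E * k x z + (s `^ (1 - r))%:E * ((f z `^ r)%:E * k x z)))%E).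
    apply: ge0_le_integral => //.
    - by move=> z _; exact: fk_ge0.
    - exact: measurable_fk.
    - apply: emeasurable_funD; apply: measurable_funeM => //.
      exact: measurable_fk.
    - move=> z _; rewrite muleA -ge0_muleDl ?lee_fin ?(ltW s0) ?mulr_ge0 ?powR_ge0//.
      rewrite lee_wpmul2r// -EFinM -EFinD lee_fin.
      have [fs|sf] := leP (f z) s; first by rewrite (le_trans fs)// lerDl mulr_ge0 ?powR_ge0.
      have fz0 := lt_trans s0 sf.
      rewrite (@le_trans _ _ (s `^ (1 - r) * f z `^ r))//; last by rewrite lerDr ltW.
      have -> : s `^ (1 - r) = (s `^ (r - 1))^-1 by rewrite -powRN opprB.
      rewrite mulrC ler_pdivlMr ?powR_gt0//.
      have -> : f z `^ r = f z * f z `^ (r - 1).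
        by rewrite -[X in X * _]powRr1 ?f0// -powRD ?(gt_eqF fz0) ?implybT// addrC subrK.
      by rewrite ler_wpM2l// ge0_ler_powR ?nnegrE ?subr_ge0 ?(ltW s0) ?(ltW sf).
  rewrite ge0_integralD//; last 4 first.
  - by move=> z _; rewrite mule_ge0 ?lee_fin// ltW.
  - exact: measurable_funeM.
  - by move=> z _; rewrite !mule_ge0 ?lee_fin ?powR_ge0.
  - by apply: measurable_funeM; exact: measurable_fk.
  rewrite !ge0_integralZl ?lee_fin ?powR_ge0 ?(ltW s0)//; last 2 first.
  - exact: measurable_fk.
  - by move=> z _; rewrite mule_ge0 ?lee_fin ?powR_ge0.
  by rewrite leeD2r// EFinM lee_pmul2l.
case E : (kernel_op (fun z => f z `^ r) x) key => [q| |]// key; last first.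
  by move=> _; rewrite gt0_muley ?lte_fin// leey.
(* If q = 0 no optimal height exists; heights tending to 0, here [e / K], force the left-hand side
   to vanish. *)
rewrite lee_fin le_eqVlt => /predU1P[q0|q0].
  suff -> : kernel_op f x = 0%E by rewrite -q0 poweR0r ?gt_eqF// mule0.
  apply/eqP; rewrite eq_le Fx0 andbT; apply/lee_addgt0Pr => e e0.
  have := key _ (divr_gt0 e0 K0).
  by rewrite -q0 mule0 adde0 divfK ?gt_eqF// add0e.
(* This height balances the two terms of [key]: s^r = q / K makes both equal to s K, whence the
   factor 2. *)
pose s := (q / K) `^ r^-1.
have s0 : 0 < s by rewrite powR_gt0// divr_gt0.
have sr : s `^ r = q / K by rewrite -powRrM mulVf ?gt_eqF// powRr1// divr_ge0// ltW.
have Fs : (kernel_op f x <= (2 * K * s)%:E)%E.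
  apply: (le_trans (key s s0)); rewrite -EFinM -EFinD lee_fin.
  rewrite powRB ?(gt_eqF s0) ?implybT// powRr1 ?(ltW s0)// sr.
  rewrite le_eqVlt; apply/orP; left; apply/eqP; field.
  by rewrite !gt_eqF.
apply: (@le_trans _ _ ((2 * K * s)%:E `^ r)%E); first by apply: ge0_le_poweR => //; exact: ltW.
rewrite poweR_EFin powRM ?(ltW s0)//; last by rewrite ltW// mulr_gt0.
by rewrite sr -EFinM lee_fin mulrA mulrAC.
Qed.

(** Schur's test. The bound [kK] enters through the pointwise inequality [kernel_op_powR_le], the
    bound [kK'] through Tonelli in [integral_kernel_op_le]. For p = +oo the constant K is enlarged
    to 2 K for uniformity. *)
Lemma Lnorm_kernel_op_le p f : (1 <= p)%E -> measurable_fun setT f ->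
  ('N[nu]_p[kernel_op (fun z => `|f z|%R)] <= (2 * K)%:E * 'N[nu]_p[EFin \o f])%E.
Proof.
move=> + mf.
have mf' : measurable_fun setT (fun z => `|f z|).
  by apply: (@measurableT_comp _ _ _ _ _ _ (@Num.norm _ R)).
have F0 x : (0 <= kernel_op (fun z => `|f z|%R) x)%E by exact: kernel_op_ge0.
case: p => [r| |]//; last first.
  move=> _; rewrite !Lnorm_yE//.
  have g0 : (0 <= ess_sup nu (abse \o (EFin \o f)))%E by rewrite -Lnorm_yE//; exact: Lnorm_ge0.
  case E : (ess_sup nu _) g0 => [M| |]//; last by move=> _; rewrite gt0_muley ?leey// lte_fin mulr_gt0.
  rewrite lee_fin => M0; apply/ess_supP; apply: nearW => x /=.
  rewrite gee0_abs//; apply: (@le_trans _ _ (M * K)%:E).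
    apply: kernel_op_le_cst => //.
    by apply: filterS (ess_sup_ge nu (abse \o (EFin \o f))) => z /=; rewrite E lee_fin.
  by rewrite -EFinM lee_fin mulrC ler_wpM2r// ler_peMl ?(ltW K0)// ler1n.
rewrite lee_fin => r1; have r0 : 0 < r by rewrite (lt_le_trans ltr01).
have KK0 : 0 < 2 * K by rewrite mulr_gt0.
have mfr : measurable_fun setT (fun z => `|f z| `^ r).
  by apply: (@measurableT_comp _ _ _ _ _ _ (@powR R ^~ r)).
rewrite !Lnorm_EFinE.
have I0 : (0 <= \int[nu]_x (`|f x| `^ r)%R%:E)%E by apply: integral_ge0 => x _; rewrite lee_fin powR_ge0.
apply: (@le_trans _ _ ((((2 * K) `^ r)%:E * \int[nu]_x (`|f x| `^ r)%R%:E) `^ r^-1)%E).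
  apply: ge0_le_poweR; first by rewrite invr_ge0 ltW.
    by apply: integral_ge0 => x _; exact: poweR_ge0.
  apply: (@le_trans _ _ (\int[nu]_x (((2 * K) `^ r / K)%:E * kernel_op (fun z => (`|f z| `^ r)%R) x))%E).
    apply: ge0_le_integral => //.
    - by move=> x _; exact: poweR_ge0.
    - by apply: measurable_abse_poweR; exact: measurable_kernel_op.
    - apply: measurable_funeM; apply: measurable_kernel_op => // z; exact: powR_ge0.
    - by move=> x _; rewrite gee0_abs//; exact: kernel_op_powR_le.
  rewrite ge0_integralZl//; last 3 first.
  - by apply: measurable_kernel_op => // z; exact: powR_ge0.
  - by move=> x _; apply: kernel_op_ge0 => z; exact: powR_ge0.
  - by rewrite lee_fin divr_ge0 ?powR_ge0// ltW.
  have -> : ((2 * K) `^ r)%:E = (((2 * K) `^ r / K)%:E * K%:E)%E by rewrite -EFinM divfK ?gt_eqF.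
  rewrite -muleA lee_wpmul2l ?lee_fin ?divr_ge0 ?powR_ge0 ?(ltW K0)//.
  by apply: integral_kernel_op_le => // z; exact: powR_ge0.
by rewrite poweRM ?lee_fin ?powR_ge0// poweR_EFin -powRrM divff ?gt_eqF// powRr1 ?(ltW KK0).
Qed.

Lemma integrable_kernel_op f x : measurable_fun setT f ->
  (kernel_op (fun z => `|f z|%R) x < +oo)%E ->
  nu.-integrable setT (fun z => (f z)%:E * k x z)%E.
Proof.
move=> mf foo; apply/integrableP; split; first exact: measurable_fk.
by under eq_integral do rewrite abseM (gee0_abs (k0 _ _)).
Qed.

Lemma kernel_op_fin_num f x : measurable_fun setT f ->
  (kernel_op (fun z => `|f z|%R) x < +oo)%E -> kernel_op f x \is a fin_num.
Proof. by move=> mf foo; apply: integrable_fin_num => //; exact: integrable_kernel_op. Qed.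

Lemma abse_kernel_op_le f x : measurable_fun setT f ->
  (`|kernel_op f x| <= kernel_op (fun z => `|f z|%R) x)%E.
Proof.
move=> mf; apply: (le_trans (le_abse_integral _ _ _)) => //; first exact: measurable_fk.
by under eq_integral do rewrite abseM (gee0_abs (k0 _ _)).
Qed.

(** Additivity of the integral needs both parts integrable against [k x]: the low part is so at
    every x because it is bounded, the high part by the finiteness hypothesis at x. *)
Lemma kernel_op_high_part M f x : measurable_fun setT f -> 0 <= M ->
  (kernel_op (fun z => `|high_part M f z|%R) x < +oo)%E ->
  kernel_op (low_part M f) x \is a fin_num /\
  kernel_op (high_part M f) x = (kernel_op f x - kernel_op (low_part M f) x)%E.
Proof.
move=> mf M0 hoo; have mh := measurable_high_part M mf; have ml := measurable_low_part M mf.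
have loo : (kernel_op (fun z => `|low_part M f z|%R) x < +oo)%E.
  apply: (@le_lt_trans _ _ (M * K)%:E); last exact: ltry.
  apply: kernel_op_le_cst => //.
    by apply: (@measurableT_comp _ _ _ _ _ _ (@Num.norm _ R)).
  by apply: nearW => z; rewrite /low_part; case: ifPn; rewrite ?normr0.
have fin := kernel_op_fin_num ml loo; split=> //.
suff -> : kernel_op f x = (kernel_op (high_part M f) x + kernel_op (low_part M f) x)%E.
  by rewrite addeK.
rewrite /kernel_op -integralD//; try exact: integrable_kernel_op.
apply: eq_integral => z _; rewrite /high_part /low_part.
by case: ifPn; rewrite mul0e ?add0e ?adde0.
Qed.

Lemma kernel_op_bounded f M x : measurable_fun setT f -> (forall z, `|f z| <= M) ->
  kernel_op f x \is a fin_num /\ `|fine (kernel_op f x)| <= M * K.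
Proof.
move=> mf fM; have M0 : 0 <= M by exact: le_trans (fM point).
have le : (kernel_op (fun z => `|f z|%R) x <= (M * K)%:E)%E.
  apply: kernel_op_le_cst => //; last exact: nearW.
  by apply: (@measurableT_comp _ _ _ _ _ _ (@Num.norm _ R)).
have fin := kernel_op_fin_num mf (le_lt_trans le (ltry _)); split => //.
by rewrite -lee_fin -abse_EFin fineK// (le_trans (abse_kernel_op_le x mf)).
Qed.

(** Transfers to bounded signed functions what is known for nonnegative ones: measurability of the
    potential and its Holder estimate. *)
Lemma kernel_op_funrposneg f M x : measurable_fun setT f -> (forall z, `|f z| <= M) ->
  [/\ kernel_op f^\+ x \is a fin_num, kernel_op f^\- x \is a fin_num &
      kernel_op f x = (kernel_op f^\+%R x - kernel_op f^\-%R x)%E].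
Proof.
move=> mf fM.
have mp : measurable_fun setT f^\+ by exact: measurable_funrpos.
have mn : measurable_fun setT f^\- by exact: measurable_funrneg.
have pM z : `|f^\+ z| <= M.
  rewrite ger0_norm ?funrpos_ge0// (le_trans _ (fM z))// /funrpos ge_max normr_ge0 andbT.
  exact: ler_norm.
have nM z : `|f^\- z| <= M.
  rewrite ger0_norm ?funrneg_ge0// (le_trans _ (fM z))// /funrneg ge_max normr_ge0 andbT.
  by rewrite -normrN ler_norm.
have int f' : measurable_fun setT f' -> (forall z, `|f' z| <= M) ->
    nu.-integrable setT (fun z => (f' z)%:E * k x z)%E.
  move=> mf' f'M; apply: integrable_kernel_op => //.
  apply: (@le_lt_trans _ _ (M * K)%:E); last exact: ltry.
  apply: kernel_op_le_cst => //; last exact: nearW.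
    by apply: (@measurableT_comp _ _ _ _ _ _ (@Num.norm _ R)).
  exact: le_trans (fM point).
split; [by have [] := kernel_op_bounded x mp pM|by have [] := kernel_op_bounded x mn nM|].
rewrite /kernel_op -integralB//; [|exact: int|exact: int].
apply: eq_integral => z _; rewrite /funrpos /funrneg.
have [fz|fz] := leP 0 (f z).
  by rewrite max_r ?oppr_le0// mul0e sube0.
by rewrite max_l ?oppr_ge0 ?(ltW fz)// mul0e sub0e EFinN mulNe oppeK.
Qed.

Lemma measurable_fine_kernel_op f M : measurable_fun setT f -> (forall z, `|f z| <= M) ->
  measurable_fun setT (fun x => fine (kernel_op f x)).
Proof.
move=> mf fM; apply: (@measurableT_comp _ _ _ _ _ _ fine); first exact: fine_measurable.
have -> : kernel_op f = (fun x => kernel_op f^\+%R x - kernel_op f^\-%R x)%E.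
  by apply/funext => x; have [] := kernel_op_funrposneg x mf fM.
apply: emeasurable_funB; apply: measurable_kernel_op => //.
- exact: measurable_funrpos.
- exact: measurable_funrneg.
Qed.

(** The factor 2 adds the contributions of the positive and the negative part, each of which lies
    between 0 and [M]. *)
Lemma fine_kernel_op_dist_le f M x y (D : R) : measurable_fun setT f ->
  (forall z, `|f z| <= M) ->
  (forall f', measurable_fun setT f' -> (forall z, 0 <= f' z) -> (forall z, f' z <= M) ->
    (kernel_op f' x <= kernel_op f' y + D%:E)%E /\
    (kernel_op f' y <= kernel_op f' x + D%:E)%E) ->
  `|fine (kernel_op f x) - fine (kernel_op f y)| <= 2 * D.
Proof.
move=> mf fM H.
have [px nx ->] := kernel_op_funrposneg x mf fM.
have [py ny ->] := kernel_op_funrposneg y mf fM.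
have pM z : f^\+ z <= M.
  by rewrite /funrpos ge_max (le_trans (ler_norm _) (fM z)) (le_trans _ (fM z)).
have nM z : f^\- z <= M.
  rewrite /funrneg ge_max (le_trans _ (fM z)) ?(le_trans _ (fM z))//.
  by rewrite -normrN ler_norm.
have [] := H _ (measurable_funrpos mf) (funrpos_ge0 f) pM.
have [] := H _ (measurable_funrneg mf) (funrneg_ge0 f) nM.
move: px nx py ny.
case: (kernel_op f^\+ x) => [a| |]// _; case: (kernel_op f^\- x) => [b| |]// _.
case: (kernel_op f^\+ y) => [a'| |]// _; case: (kernel_op f^\- y) => [b'| |]// _.
rewrite -!EFinD !lee_fin /= ler_norml; lra.
Qed.

End kernel_operator.

(** * Density *)

Section profile.
Context (R : realType).

Lemma lipschitz_on_segment (H : R -> R) (a b : R) : a <= b -> smooth H ->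
  exists2 L : R, 0 <= L &
    forall x y, a <= x -> x <= y -> y <= b -> `|H y - H x| <= L * (y - x).
Proof.
move=> ab sH; pose H' := derive1 H.
have dH x : derivable H x 1 by exact: (sH 0%N).
have cH' : continuous H'.
  move=> x; apply: differentiable_continuous; apply/derivable1_diffP.
  exact: (sH 1%N).
have [z _ zmax] : exists2 z, z \in `[a, b] & forall t, t \in `[a, b] -> `|H' t| <= `|H' z|.
  apply: EVT_max => //; apply: continuous_subspaceT => x.
  by apply: continuous_comp; [exact: cH'|exact: norm_continuous].
exists `|H' z| => // x y ax xy yb.
have [||t txy ->] := @MVT_segment _ H H' x y xy.
- by move=> t _; rewrite /H' derive1E; exact: DeriveDef.
- by apply: continuous_subspaceT => t; apply: differentiable_continuous; apply/derivable1_diffP.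
rewrite normrM [`|y - x|]ger0_norm ?subr_ge0// ler_wpM2r ?subr_ge0// zmax//.
by move: txy; rewrite !in_itv/= => /andP[xt ty]; rewrite (le_trans ax)//= (le_trans ty).
Qed.

(* Values of h at negative arguments are junk, whereas joint measurability in
   (x, y, t) requires a profile controlled on the whole line. *)
Lemma lipschitz_bump_profile (h : R -> R) : admissible_profile h ->
  exists L, lipschitz_bump (fun r => h (Num.max r 0)) L.
Proof.
move=> [[H sH Hh] h0 hd h1 hz].
have [L L0 lipH] := @lipschitz_on_segment H 0 2 (ler0n _ 2) sH.
have max0 (r : R) : 0 <= Num.max r 0 by rewrite le_max lexx orbT.
have anti : {homo (fun r => h (Num.max r 0)) : r s /~ r <= s}.
  by move=> r s rs; apply: hd => //; rewrite ge_max le_max rs/= le_max lexx orbT.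
exists L; split.
- by apply: nonincreasing_measurable => // r s; exact: anti.
- by move=> r; exact: h0.
- by move=> r; rewrite -(h1 0 (lexx _)) ?invr_ge0//; exact: hd.
- by move=> r r2; rewrite h1// ge_max r2 invr_ge0 ler0n.
- by move=> r r2; rewrite hz// le_max r2.
- suff lip r s : r <= s -> `|h (Num.max r 0) - h (Num.max s 0)| <= L * (s - r).
    move=> r s; have [rs|sr] := leP r s.
      by apply: (le_trans (lip r s rs)); rewrite distrC ger0_norm ?subr_ge0.
    rewrite distrC; apply: (le_trans (lip s r (ltW sr))).
    by rewrite ger0_norm// subr_ge0 ltW.
  move=> rs.
  have [s2|s2] := leP (Num.max s 0) 2.
    have rs' : Num.max r 0 <= Num.max s 0 by rewrite ge_max le_max rs/= max0.
    rewrite -!Hh// distrC; apply: (le_trans (lipH _ _ (max0 r) rs' s2)).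
    rewrite ler_wpM2l//; move: rs; case: (leP r 0) => r0; case: (leP s 0) => s0; lra.
  have [r2|r2] := leP (Num.max r 0) 2; last first.
    by rewrite !hz ?subrr ?normr0 ?(ltW r2) ?(ltW s2)// mulr_ge0// subr_ge0.
  (* The profile is 0 from 2 on, so the larger argument can be moved back to 2; this is why a
     Lipschitz constant on the segment from 0 to 2 is enough. *)
  have -> : h (Num.max s 0) = H 2 by rewrite Hh ?ler0n// !hz// ltW.
  rewrite -Hh// distrC.
  apply: (le_trans (lipH _ _ (max0 r) r2 (lexx _))).
  rewrite ler_wpM2l//; move: s2; case: (leP s 0) => s0; case: (leP r 0) => r0; lra.
Qed.

End profile.

(** * Approximation by potentials of truncated functions *)

Section density.
Context d (R : realType) (X : measurableMetricType d R).
Hypothesis hX : is_borel X.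

Lemma s_kernel_ext (m : {measure set X -> \bar R}) (N : R) (h h' : R -> R) (x y : X) (t : R) :
  (forall r, 0 <= r -> h r = h' r) -> 0 < t ->
  s_kernel m N h x y t = s_kernel m N h' x y t.
Proof.
move=> hh t0.
have hE (u v : X) : h (mdist u v / t) = h' (mdist u v / t).
  by rewrite hh// divr_ge0 ?mdist_ge0// ltW.
have A f z : avg_op m N h t f z = avg_op m N h' t f z.
  by rewrite /avg_op; congr (_ * _); apply: eq_Rintegral => u _; rewrite hE.
have P z : psi m N h z t = psi m N h' z t.
  rewrite /psi A; have -> // : (fun y => (avg_op m N h t (cst 1) y)^-1) =
    (fun y => (avg_op m N h' t (cst 1) y)^-1).
  by apply/funext => u; rewrite A.
have I : \int[m]_z (h (mdist x z / t) * h (mdist y z / t) * psi m N h z t) =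
    \int[m]_z (h' (mdist x z / t) * h' (mdist y z / t) * psi m N h' z t).
  by apply: eq_Rintegral => z _; rewrite P !hE.
rewrite /s_kernel /phi !A.
exact: (congr1 (fun i => _ * i) I).
Qed.

(** Only arguments [mdist x y / t] with t > 0 matter, so the given profile may be exchanged for its
    clamped version, to which the kernel estimates apply. *)
Lemma bessel_potential_ext (m : {measure set X -> \bar R}) (N : R) (h h' : R -> R) (alpha : R) :
  (forall r, 0 <= r -> h r = h' r) ->
  bessel_potential m N h alpha = bessel_potential m N h' alpha.
Proof.
move=> hh.
have kE x z : bessel_kernel m N h alpha x z = bessel_kernel m N h' alpha x z.
  have I : (\int[@lebesgue_measure R]_(t in `]0%R, +oo[)
      (t `^ alpha / (1 + t `^ alpha) ^+ 2 * s_kernel m N h x z t / t)%:E =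
    \int[@lebesgue_measure R]_(t in `]0%R, +oo[)
      (t `^ alpha / (1 + t `^ alpha) ^+ 2 * s_kernel m N h' x z t / t)%:E)%E.
    apply: eq_integral => t; rewrite inE/= in_itv/= andbT => t0.
    by have -> : s_kernel m N h x z t = s_kernel m N h' x z t by exact: s_kernel_ext.
  exact: (congr1 (fun I => alpha%:E * I)%E I).
apply/funext => g; apply/funext => x; rewrite /bessel_potential.
by apply: eq_integral => z _; rewrite kE.
Qed.

Variables (m : {sigma_finite_measure set X -> \bar R}) (N c : R).
Hypothesis c0 : 0 < c.
Hypothesis m0 : (0 < m setT)%E.
Hypothesis reg : forall (x : X) (r : R), 0 < r ->
  ((c^-1 * r `^ N)%:E <= m (ball x r) <= (c * r `^ N)%:E)%E.
Variables (h : R -> R).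
Hypothesis hh : admissible_profile h.
Variable alpha : R.
Hypothesis alpha0 : 0 < alpha.

(** Everything the density argument needs to know about J_alpha, with the kernel left abstract. The
    second of the two integral bounds is the first one read through the symmetry of the kernel. *)
Lemma bessel_potential_kernel_op (beta : R) : 0 < beta -> beta < 1 -> beta <= alpha ->
  exists k : X -> X -> \bar R, exists K C : R,
  [/\ bessel_potential m N h alpha = kernel_op m k,
      measurable_fun setT (fun q : X * X => k q.1 q.2),
      forall x y, (0 <= k x y)%E,
      [/\ 0 < K, forall x, (\int[m]_y k x y <= K%:E)%E &
          forall y, (\int[m]_x k x y <= K%:E)%E] &
      forall (f : X -> R) (M : R) (x y : X),
        measurable_fun setT f -> (forall z, 0 <= f z) -> (forall z, f z <= M) -> x != y ->
        (kernel_op m k f x <= kernel_op m k f y + (M * C * mdist x y `^ beta)%:E)%E].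
Proof.
move=> b0 b1 ba.
have [L hL] := lipschitz_bump_profile hh.
set h' := (fun r => _) in hL.
have hh' r : 0 <= r -> h r = h' r by move=> r0; rewrite /h' max_l.
have [K K0 kK] := integral_bessel_kernel_le hX c0 reg hL alpha0.
have [C _ kC] := integral_bessel_kernel_lip hX c0 reg hL alpha0 b0 b1 ba.
exists (bessel_kernel m N h' alpha), K, C; split.
- exact: bessel_potential_ext.
- exact: (measurable_bessel_kernel hX c0 reg hL alpha (T := (X * X)%type) (u := fst) (v := snd)).
- by move=> x y; exact: (bessel_kernel_ge0 _ _ hL alpha0).
- split; [exact: K0|exact: kK|].
  by move=> y; under eq_integral do rewrite bessel_kernelC; exact: kK.
- exact: kC.
Qed.

(** The constant [K] does not depend on the height [M], whereas the Holder constant of u grows with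
    it; this is what lets [M] be chosen afterwards. *)
Lemma low_part_potential_holder (beta : R) (p : \bar R) :
  0 < beta -> beta < 1 -> beta <= alpha -> (1 <= p)%E ->
  exists2 K : R, 0 < K & forall (f g : X -> R) (M : R), 0 <= M -> measurable_fun setT f ->
    bessel_preimage m N h alpha p f g ->
    exists2 u, (holder_space m beta `&` potential_space m N h alpha p) u &
      (potential_norm m N h alpha p (f - u)%R <= K%:E * 'N[m]_p[EFin \o high_part M g])%E.
Proof.
move=> b0 b1 ba p1.
have [k [K [C [JE mk k0 [K0 kK kK'] kC]]]] := bessel_potential_kernel_op b0 b1 ba.
(* The term 2 K is the Schur bound for the L^p norm of f - u; the term 1 is for the infimum,
   attested by the preimage [w]. *)
exists (2 * K + 1); first by rewrite addr_gt0// mulr_gt0.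
move=> f g M M0 mf [gp Jg].
have [mg _] := LfunE gp.
set w := high_part M g.
pose l := low_part M g.
have mw : measurable_fun setT w by exact: measurable_high_part.
have ml : measurable_fun setT l by exact: measurable_low_part.
have lM z : `|l z| <= M by rewrite /l /low_part; case: ifPn; rewrite ?normr0.
have wp : w \in Lfun m p.
  by apply: Lfun_le gp => // z; rewrite /w /high_part; case: ifPn; rewrite ?normr0.
have lp : l \in Lfun m p.
  by apply: Lfun_le gp => // z; rewrite /l /low_part; case: ifPn; rewrite ?normr0.
(* Since [l] is bounded its potential is finite everywhere, so [fine] loses nothing and u is Holder
   at every pair of points. *)
pose u x := fine (kernel_op m k l x).
have mu_ : measurable_fun setT u by exact: (measurable_fine_kernel_op mk k0 kK ml lM).
have lu x : kernel_op m k l x = (u x)%:E.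
  by have [fin _] := kernel_op_bounded mk k0 kK x ml lM; rewrite /u fineK.
have mabs : measurable_fun setT (fun z => `|w z|).
  exact: (@measurableT_comp _ _ _ _ _ _ (@Num.norm _ R)).
have mopw : measurable_fun setT (kernel_op m k (fun z => `|w z|)).
  exact: measurable_kernel_op.
have opw0 x : (0 <= kernel_op m k (fun z => `|w z|%R) x)%E by apply: kernel_op_ge0.
have opwfin : \forall x \ae m, (kernel_op m k (fun z => `|w z|%R) x < +oo)%E.
  have : \forall x \ae m, (`|kernel_op m k (fun z => `|w z|%R) x| < +oo)%E.
    apply: (Lnorm_lty_ae m0 p1 mopw).
    apply: (le_lt_trans (Lnorm_kernel_op_le m0 mk k0 K0 kK kK' p1 mw)).
    have [_ wfin] := LfunE wp; apply: lte_mul_pinfty wfin => //.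
    by rewrite lee_fin mulr_ge0// ltW.
  by apply: filterS => x; rewrite gee0_abs.
(* Holds only almost everywhere, for two reasons: f is the potential of g up to a null set, and the
   potential of [w] has to be finite. *)
have wfu : \forall x \ae m, kernel_op m k w x = (f x - u x)%:E.
  move: Jg; rewrite JE => Jg; apply: filterS2 Jg opwfin => x /(_ I) Jg opw.
  have [_ ->] := kernel_op_high_part mk k0 kK mg M0 opw.
  by rewrite Jg -/l lu.
exists u.
  split.
    exists u; split.
    - by exists (M * K) => x; have [] := kernel_op_bounded mk k0 kK x ml lM.
    - apply: (@le_lt_trans _ _ (2 * (M * C))%:E); last exact: ltry.
      apply: ge_ereal_sup => _ [x [y [xy ->]]].
      have xy0 : 0 < mdist x y by rewrite mdist_gt0.
      rewrite lee_fin ler_pdivrMr ?powR_gt0// -mulrA.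
      apply: (fine_kernel_op_dist_le mk k0 kK ml lM) => f' mf' f'0 f'M.
      split; first exact: kC.
      by rewrite (metric_sym x); apply: kC => //; rewrite eq_sym.
    - exact: nearW.
  split => //; exists l; split => //.
  by rewrite JE; apply: nearW => x _; rewrite lu.
rewrite EFinD ge0_muleDl ?lee_fin ?mulr_ge0 ?(ltW K0)// mul1e; apply: leeD.
  apply: le_trans (Lnorm_kernel_op_le m0 mk k0 K0 kK kK' p1 mw); apply: le_Lnorm => //.
    by apply/measurable_EFinP; exact: measurable_funB.
  apply: filterS wfu => x wx; rewrite [leRHS]gee0_abs//.
  have -> : (EFin \o (f - u)%R) x = kernel_op m k w x by rewrite wx.
  exact: (abse_kernel_op_le m mk k0).
apply: ereal_inf_lbound; exists w => //; split => //.
by rewrite JE; apply: filterS wfu => x wx _; rewrite wx.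
Qed.

Lemma potential_space_holder_dense (beta : R) (p : \bar R) :
  0 < beta -> beta < 1 -> beta <= alpha -> (1 <= p)%E ->
  dense_for (potential_norm m N h alpha p)
    (holder_space m beta `&` potential_space m N h alpha p)
    (potential_space m N h alpha p).
Proof.
move=> b0 b1 ba p1; split; first by move=> f [].
have [K K0 HK] := low_part_potential_holder b0 b1 ba p1.
move=> f [mf [g gf]] e e0.
have [n hn] := Lnorm_high_part_lt m0 p1 (divr_gt0 e0 K0) gf.1.
have [u hu fu] := HK f g n%:R (ler0n _ n) mf gf.
exists u; first exact: hu.
apply: (le_lt_trans fu); have := Lnorm_ge0 m p (EFin \o high_part n%:R g); move: hn.
case: ('N[m]_p[EFin \o high_part n%:R g])%E => [q| |]//.
by rewrite lte_fin => qe _; rewrite -EFinM lte_fin mulrC -ltr_pdivlMr.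
Qed.

End density.

Theorem corollary4p6 (d : measure_display) (R : realType)
  (X : measurableMetricType d R) (hX : is_borel X)
  (m : {measure set X -> \bar R}) (hm : m [set: X] = +oo%E)
  (N : R) (hN : 0 < N) (hreg : ahlfors_regular m N)
  (h : R -> R) (hh : admissible_profile h)
  (p : \bar R) (hp : (1 <= p)%E) (alpha : R) (halpha : 0 < alpha) :
  (alpha < 1 -> forall beta : R, 0 < beta -> beta <= alpha ->
     dense_for (potential_norm m N h alpha p)
       (holder_space m beta `&` potential_space m N h alpha p)
       (potential_space m N h alpha p)) /\
  (1 <= alpha -> forall beta : R, 0 < beta -> beta < 1 ->
     dense_for (potential_norm m N h alpha p)
       (holder_space m beta `&` potential_space m N h alpha p)
       (potential_space m N h alpha p)).
Proof.
case: hreg => c c0 reg.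
have [nu E] := sigma_finite_measure_of (ahlfors_sigma_finite hX reg).
subst m; have nu0 : (0 < nu setT)%E by have -> : nu setT = +oo%E by exact: hm.
(* In the first case beta <= alpha < 1 supplies beta < 1; in the second beta < 1 <= alpha supplies
   beta <= alpha. *)
split=> a1 beta b0 b1; apply: (potential_space_holder_dense hX c0 nu0 reg hh) => //.
- exact: le_lt_trans a1.
- exact: le_trans (ltW b1) a1.
Qed.
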